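(* Let $\Gamma=(V,E,m)$ be an even, finite Artin graph of FC-type, and let $G_\Gamma$ be the Artin group based on $\Gamma$. Then any arbitrary intersection $\bigcap_{i\in I}P_i$ of parabolic subgroups $P_i$ of $G_\Gamma$ (with $I$ an arbitrary index set) is a parabolic subgroup of $G_\Gamma$.
   Context: An Artin graph $\Gamma=(V,E,m)$ consists of a set $V$ of vertices, a set $E$ of two-element subsets of $V$ (edges), and a labelling $m\colon E\to\{2,3,4,\dots\}$; write $m_{u,v}=m(\{u,v\})$. It is finite if $V$ is finite, and even if all labels are even. Let $\mathrm{prod}(u,v,n)$ denote the prefix of length $n$ of the infinite alternating word $uvuvuv\cdots$. The Artin group based on $\Gamma$ is $$G_\Gamma=\langle V\mid \mathrm{prod}(u,v,m_{u,v})=\mathrm{prod}(v,u,m_{u,v})\ \ \forall \{u,v\}\in E\rangle,$$ and the Coxeter group $C_\Gamma$ is the quotient of $G_\Gamma$ by the additional relations $v^2=1$ for all $v\in V$. $\Gamma$ is of spherical type if $C_\Gamma$ is finite. For $S\subseteq V$, $G_S$ denotes the subgroup of $G_\Gamma$ generated by $S$ (a standard parabolic subgroup; by a theorem of Van der Lek it is canonically the Artin group of the subgraph of $\Gamma$ induced by $S$). A subgroup is parabolic if it equals $gG_Sg^{-1}$ for some $g\in G_\Gamma$ and $S\subseteq V$. $\Gamma$ is of FC-type if every induced complete subgraph of $\Gamma$ is of spherical type; for even $\Gamma$ this is equivalent to: in every triangle $\{u,v\},\{v,w\},\{w,u\}\in E$ at least two of $m_{u,v},m_{v,w},m_{w,u}$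 equal $2$. *)

(* Defs.v *)
From HB Require Import structures.
From mathcomp Require Import all_boot.
From mathcomp Require Import boolp classical_sets cardinality.

Set Implicit Arguments.
Unset Strict Implicit.
Unset Printing Implicit Defensive.

Local Open Scope classical_set_scope.
Local Open Scope quotient_scope.
Local Open Scope group_scope.

(* A letter (v, true) stands for the generator v, and (v, false) for its
   formal inverse. *)
Definition word (V : choiceType) := seq (V * bool).

Definition word_inv (V : choiceType) (w : word V) : word V :=
  rev [seq (a.1, ~~ a.2) | a <- w].

Definition pos_word (V : choiceType) (s : seq V) : word V :=
  [seq (v, true) | v <- s].

Section PresentedGroup.
Variables (V : choiceType) (R : word V -> word V -> Prop).

(* w1 and w2 represent the same element of < V | l = r for all R l r >. *)
Inductive word_eq : word V -> word V -> Prop :=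
| word_eq_refl w : word_eq w w
| word_eq_sym w1 w2 : word_eq w1 w2 -> word_eq w2 w1
| word_eq_trans w1 w2 w3 : word_eq w1 w2 -> word_eq w2 w3 -> word_eq w1 w3
| word_eq_cancel p q v b : word_eq (p ++ (v, b) :: (v, ~~ b) :: q) (p ++ q)
| word_eq_rel p q l r : R l r -> word_eq (p ++ l ++ q) (p ++ r ++ q).

Definition word_eqb (w1 w2 : word V) : bool := `[< word_eq w1 w2 >].

Lemma word_eqb_refl : reflexive word_eqb.
Proof. by move=> w; apply/asboolP; exact: word_eq_refl. Qed.

Lemma word_eqb_sym : symmetric word_eqb.
Proof. by move=> w1 w2; apply/asboolP/asboolP => /word_eq_sym. Qed.

Lemma word_eqb_trans : transitive word_eqb.
Proof.
move=> w2 w1 w3 /asboolP h1 /asboolP h2; apply/asboolP.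
exact: word_eq_trans h1 h2.
Qed.

Canonical word_equiv := EquivRel word_eqb word_eqb_refl word_eqb_sym
  word_eqb_trans.

Definition presented_group := {eq_quot word_equiv}.
HB.instance Definition _ := Choice.on presented_group.
HB.instance Definition _ := EqQuotient.on presented_group.

Definition of_word (w : word V) : presented_group := \pi w.

Definition pg_one : presented_group := of_word [::].
Definition pg_mul (x y : presented_group) : presented_group :=
  of_word (repr x ++ repr y).
Definition pg_inv (x : presented_group) : presented_group :=
  of_word (word_inv (repr x)).

Lemma of_wordP w1 w2 : of_word w1 = of_word w2 <-> word_eq w1 w2.
Proof.
split; first by move/eqmodP => /asboolP.
by move=> h; apply/eqmodP/asboolP.
Qed.

Lemma repr_of_word w : word_eq (repr (of_word w)) w.
Proof. by apply/of_wordP; rewrite /of_word reprK. Qed.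

Lemma word_eq_ctx p q w1 w2 :
  word_eq w1 w2 -> word_eq (p ++ w1 ++ q) (p ++ w2 ++ q).
Proof.
elim=> {w1 w2} [w | w1 w2 _ | w1 w2 w3 _ h1 _ h2 | p' q' v b | p' q' l r Rlr].
- exact: word_eq_refl.
- exact: word_eq_sym.
- exact: word_eq_trans h1 h2.
- by have := word_eq_cancel (p ++ p') (q' ++ q) v b; rewrite -!catA.
- by have := word_eq_rel (p ++ p') (q' ++ q) Rlr; rewrite -!catA.
Qed.

Lemma word_eq_cat w1 w2 w1' w2' :
  word_eq w1 w1' -> word_eq w2 w2' -> word_eq (w1 ++ w2) (w1' ++ w2').
Proof.
move=> h1 h2; apply: (@word_eq_trans _ (w1' ++ w2)).
  exact: (@word_eq_ctx [::] w2).
by have := @word_eq_ctx w1' [::] _ _ h2; rewrite !cats0.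
Qed.

Lemma of_wordM w1 w2 : pg_mul (of_word w1) (of_word w2) = of_word (w1 ++ w2).
Proof. by apply/of_wordP; apply: word_eq_cat; exact: repr_of_word. Qed.

Lemma word_inv_cons (a : V * bool) (w : word V) :
  word_inv (a :: w) = word_inv w ++ [:: (a.1, ~~ a.2)].
Proof. by rewrite /word_inv /= rev_cons -cats1. Qed.

Lemma word_mulVw (w : word V) : word_eq (word_inv w ++ w) [::].
Proof.
elim: w => [|[v b] w IHw]; first exact: word_eq_refl.
rewrite word_inv_cons -catA /=; apply: word_eq_trans IHw.
by have := word_eq_cancel (word_inv w) w v (~~ b); rewrite negbK.
Qed.

Lemma word_mulwV (w : word V) : word_eq (w ++ word_inv w) [::].
Proof.
elim: w => [|[v b] w IHw]; first exact: word_eq_refl.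
rewrite word_inv_cons catA /= -[_ :: _]/([:: (v, b)] ++ _).
apply: word_eq_trans (word_eq_cancel [::] [::] v b).
exact: (word_eq_ctx [:: (v, b)] [:: (v, ~~ b)] IHw).
Qed.

Lemma pg_mulA : associative pg_mul.
Proof.
move=> x y z; rewrite -[x]reprK -[y]reprK -[z]reprK.
by rewrite -!/(of_word _) !of_wordM catA.
Qed.

Lemma pg_mul1 : left_id pg_one pg_mul.
Proof. by move=> x; rewrite -[x]reprK -/(of_word _) of_wordM. Qed.

Lemma pg_mulr1 : right_id pg_one pg_mul.
Proof. by move=> x; rewrite -[x]reprK -/(of_word _) of_wordM cats0. Qed.

Lemma pg_mulV : left_inverse pg_one pg_inv pg_mul.
Proof.
move=> x; rewrite -[X in pg_mul _ X]reprK of_wordM.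
by apply/of_wordP; exact: word_mulVw.
Qed.

Lemma pg_mulrV : right_inverse pg_one pg_inv pg_mul.
Proof.
move=> x; rewrite -[X in pg_mul X _]reprK of_wordM.
by apply/of_wordP; exact: word_mulwV.
Qed.

HB.instance Definition _ := isGroup.Build presented_group
  pg_mulA pg_mul1 pg_mulr1 pg_mulV pg_mulrV.

Definition gen (v : V) : presented_group := of_word [:: (v, true)].

End PresentedGroup.

(* Only the restriction of label to edges is meaningful. *)
Record artin_graph (V : choiceType) := ArtinGraph {
  edge : rel V;
  label : V -> V -> nat;
  edge_sym : symmetric edge;
  edge_irr : irreflexive edge;
  label_sym : forall u v, edge u v -> label u v = label v u;
  label_ge2 : forall u v, edge u v -> 2 <= label u v
}.

Section ArtinGroups.
Variables (V : choiceType) (Gamma : artin_graph V).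

Definition even_graph := forall u v, edge Gamma u v -> ~~ odd (label Gamma u v).

Definition complete_graph := forall u v, u != v -> edge Gamma u v.

(* The prefix of length n of the infinite word u v u v ... *)
Fixpoint prod_word (u v : V) (n : nat) : seq V :=
  if n is n'.+1 then u :: prod_word v u n' else [::].

Inductive artin_rel : word V -> word V -> Prop :=
| ArtinRel u v of edge Gamma u v :
    artin_rel (pos_word (prod_word u v (label Gamma u v)))
              (pos_word (prod_word v u (label Gamma u v))).

Inductive coxeter_rel : word V -> word V -> Prop :=
| CoxeterArtin l r of artin_rel l r : coxeter_rel l r
| CoxeterInvol v : coxeter_rel (pos_word [:: v; v]) [::].

Definition artin_group := presented_group artin_rel.

Definition coxeter_group := presented_group coxeter_rel.

Definition spherical := finite_set [set: coxeter_group].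

End ArtinGroups.

Section Induced.
Variables (V : choiceType) (Gamma : artin_graph V) (S : {pred V}).

Definition induced : artin_graph {v : V | v \in S} :=
  @ArtinGraph {v : V | v \in S}
    (fun u v => edge Gamma (val u) (val v))
    (fun u v => label Gamma (val u) (val v))
    (fun u v => edge_sym Gamma (val u) (val v))
    (fun u => edge_irr Gamma (val u))
    (fun u v => @label_sym V Gamma (val u) (val v))
    (fun u v => @label_ge2 V Gamma (val u) (val v)).

End Induced.

Definition FC_type (V : choiceType) (Gamma : artin_graph V) :=
  forall S : {pred V},
    complete_graph (induced Gamma S) -> spherical (induced Gamma S).

Definition subgroup (G : groupType) (H : set G) :=
  [/\ H 1, forall x y, H x -> H y -> H (x * y) & forall x, H x -> H x^-1].

Definition generated_subgroup (G : groupType) (A : set G) : set G :=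
  smallest (@subgroup G) A.

Definition conj_set (G : groupType) (g : G) (H : set G) : set G :=
  [set g * x * g^-1 | x in H].

Section Parabolic.
Variables (V : choiceType) (Gamma : artin_graph V).

Definition artin_gen (v : V) : artin_group Gamma := gen (artin_rel Gamma) v.

Definition standard_parabolic (S : {pred V}) : set (artin_group Gamma) :=
  generated_subgroup [set artin_gen v | v in [set v | v \in S]].

Definition parabolic (P : set (artin_group Gamma)) :=
  exists (g : artin_group Gamma) (S : {pred V}),
    P = conj_set g (standard_parabolic S).

End Parabolic.

(* Main.v *)
Require Import Defs.
From mathcomp Require Import all_boot.
From mathcomp Require Import ssralg ssrint zify.
From mathcomp Require Import boolp classical_sets cardinality.

Set Implicit Arguments.
Unset Strict Implicit.
Unset Printing Implicit Defensive.

Local Open Scope classical_set_scope.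
Local Open Scope group_scope.

(** The labels being even, deleting from a word all letters outside S respects
    the relations, so every standard parabolic G_S is a retract of G, with
    retraction [ret S], and [ret S] composed with [ret T] is [ret (S :&: T)].
    This alone gives most of the formal properties: G_S is the fixed set of
    [ret S], a parabolic subgroup inside G_S is a G_S-conjugate of some G_B with
    B inside S, and a parabolic containing the whole intersection with a type of
    minimal size is the intersection as soon as two parabolics intersect in a
    parabolic ([parabolic_bigcap]).

    For two parabolics the retractions reduce the question to G_A and one of its
    own conjugates gG_Ag^-1, and then, after changing g by an element of G_A, to
    g in the kernel of [ret A]; for such g the intersection is the centralizer
    of g in G_A ([inter_conj_centralizer]).  The induction is on the set S of
    generators in use, and one generator z is removed at a time, so A = S minus
    z ([inter_conj_mono]).

    If some generator of S is not joined to z, then G_S is the amalgam of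
    G_(S minus z) and of the group of the star of z, and an element fixing two
    vertices of the Bass-Serre tree fixes the path between them.  Two
    consecutive edges of the path have a parabolic common stabilizer, by
    induction, because they meet in a vertex whose stabilizer has fewer
    generators; and so has the whole path, again by induction
    ([noncone_inter_conj]).

    If z is joined to all of L = S minus z and all these edges have label 2,
    then z is central.  Otherwise choose u in L whose edge to z has label at
    least 4.  By the FC condition ([FC_triangle]) whatever is joined to both u
    and z commutes with both.  If u also is joined to everything, G_S is the
    product of the dihedral Artin group on z and u with a standard parabolic,
    and the centralizer is read off from the dihedral factor
    ([dihedral_inter_conj]).  If u is not joined to everything, G_S acts on the
    Bass-Serre tree of the splitting along the star of u.  The subgroup G_L
    preserves a subtree which is a strict fundamental domain for the kernel of
    [ret L].  An element g other than 1 of this kernel either moves the subtree off itself,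
    and what commutes with g fixes the end of the bridge between the subtree and
    its image, or g fixes a vertex of it; in both cases the centralizer of g in
    G_L lies in a proper parabolic omitting a generator that is not joined to
    everything, which is the case already treated ([fixed_tree_inter_conj]).

    Trees do not appear explicitly: all arguments are carried out on reduced
    words of an amalgam ([reduced], [free_amalgam]).  That both splittings, and
    that of a dihedral Artin group over its centre, really are amalgams is
    obtained by letting the group act on normal forms ([ping_pong]). *)

(** * Subgroups of an arbitrary group *)

Section Subgroups.
Variable G : groupType.
Implicit Types (A H : set G) (g x y : G).

Lemma subgroup1 H : subgroup H -> H 1.
Proof. by case. Qed.

Lemma subgroupM H x y : subgroup H -> H x -> H y -> H (x * y).
Proof. by case=> _ + _; apply. Qed.

Lemma subgroupV H x : subgroup H -> H x -> H x^-1.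
Proof. by case=> _ _; apply. Qed.

Lemma subgroupMl H x y : subgroup H -> H x -> H (x * y) -> H y.
Proof.
move=> sH Hx Hxy; rewrite -[y](mulKg x); apply: subgroupM => //.
exact: subgroupV.
Qed.

Lemma subgroupMr H x y : subgroup H -> H y -> H (x * y) -> H x.
Proof.
move=> sH Hy Hxy; rewrite -[x](mulgK y); apply: subgroupM => //.
exact: subgroupV.
Qed.

Lemma subgroupJ H x y : subgroup H -> H x -> H y -> H (x ^ y).
Proof.
move=> sH Hx Hy; rewrite conjgE; do 2?[apply: subgroupM => //].
exact: subgroupV.
Qed.

Lemma subgroup_generated A : subgroup (generated_subgroup A).
Proof.
split=> [B [sB _]|x y Ax Ay B AB|x Ax B AB]; first exact: subgroup1.
  by case: (AB) => sB _; apply: subgroupM => //; [exact: Ax|exact: Ay].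
by case: (AB) => sB _; apply: subgroupV => //; exact: Ax.
Qed.

Lemma mem_generated A x : A x -> generated_subgroup A x.
Proof. by move=> Ax B [_]; apply. Qed.

Lemma generated_sub A H :
  subgroup H -> A `<=` H -> generated_subgroup A `<=` H.
Proof. by move=> sH AH x; apply. Qed.

(** Induction on the length of a product of generators and inverses; unlike
    [generated_sub] it serves for predicates that are not subgroups. *)
Lemma generated_ind A (P : set G) :
    P 1 -> (forall a x, A a -> P x -> P (a * x)) ->
    (forall a x, A a -> P x -> P (a^-1 * x)) ->
  generated_subgroup A `<=` P.
Proof.
move=> P1 PM PV y Ay.
suff main x : (P x -> P (y * x)) /\ (P x -> P (y^-1 * x)).
  by rewrite -[y]mulg1; apply: (main 1).1.
move: y Ay x; apply: generated_sub => [|a Aa x]; last first.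
  by split; [exact: PM|exact: PV].
split=> [x|a b aP bP x|a aP x].
- by rewrite invg1 mul1g.
- have [a1 a2] := aP (b * x); have [b1 b2] := bP x.
  have [a3 a4] := aP x; have [b3 b4] := bP (a^-1 * x).
  by rewrite invgM -!mulgA; split=> Px; [apply/a1/b1|apply/b4/a4].
- by rewrite invgK; have [a1 a2] := aP x; split.
Qed.

Lemma subgroup_commute g : subgroup [set x | commute x g].
Proof.
split=> [|x y xg yg|x xg] /=; apply: commute_sym.
- exact: commute1.
- by apply: commuteM; apply: commute_sym.
- by apply: commuteV; apply: commute_sym.
Qed.

Lemma conj_setE g H x : conj_set g H x <-> H (x ^ g).
Proof.
split=> [[y Hy <-]|Hx]; first by rewrite conjgE !gnorm.
by exists (x ^ g) => //; rewrite conjgE !gnorm.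
Qed.

End Subgroups.

(** * Amalgams and their normal forms *)

Section NormalForms.
Variables (G : groupType) (Gs : bool -> set G).

(** The two factors are the subgroups [Gs true] and [Gs false] of one ambient
    group, and the amalgamated subgroup is their intersection. *)
Definition common : set G := Gs true `&` Gs false.

Inductive reduced : bool -> set G :=
| reduced_syllable i s of Gs i s & ~ common s : reduced i s
| reduced_cons i s x of Gs i s & ~ common s & reduced (~~ i) x :
    reduced i (s * x).

(** The normal form theorem taken as a definition: a nonempty alternating product
    is never in the amalgamated subgroup, and the factor containing its first
    syllable is determined by its value.  The ambient group may be larger than
    the subgroup generated by the two factors. *)
Record free_amalgam : Prop := FreeAmalgam {
  amalgam_subgroup : forall i, subgroup (Gs i);
  reduced_not_common : forall i x, reduced i x -> ~ common x;
  reduced_disjoint : forall i x, reduced i x -> ~ reduced (~~ i) x }.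

(** The representative is chosen from the right coset as a set, which makes it
    constant on the coset. *)
Definition coset_rep (a : G) : G := xget 1 [set t | common (t * a^-1)].

(** The pair (h, [:: (i1, t1); ...; (in, tn)]) stands for the product
    h t1 ... tn, where h is in the amalgamated subgroup and the t's are chosen
    right coset representatives, taken alternately from the two factors. *)
Definition nform := (G * seq (bool * G))%type.

Fixpoint syllables (s : seq (bool * G)) : Prop :=
  if s is (i, t) :: s' then
    [/\ Gs i t, ~ common t, coset_rep t = t, ohead (unzip1 s') <> Some i
      & syllables s']
  else True.

Definition normal (w : nform) : Prop := common w.1 /\ syllables w.2.

Definition head_type (w : nform) : option bool := ohead (unzip1 w.2).

(** Moves the first syllable into the head if it comes from the factor [i], so
    that the normal forms become pairs of an element of [Gs i] and a list not
    starting in [Gs i]; [join_head] is the inverse. *)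
Definition split_head (i : bool) (w : nform) : nform :=
  if w.2 is (j, t) :: s then if j == i then (w.1 * t, s) else w else w.

Definition join_head (i : bool) (w : nform) : nform :=
  if `[< common w.1 >] then w
  else (w.1 * (coset_rep w.1)^-1, (i, coset_rep w.1) :: w.2).

Definition act (i : bool) (a : G) (w : nform) : nform :=
  let w' := split_head i w in join_head i (a * w'.1, w'.2).

Hypothesis sGs : forall i, subgroup (Gs i).

Lemma subgroup_common : subgroup common.
Proof.
split=> [|x y [x1 x2] [y1 y2]|x [x1 x2]]; split.
- exact: subgroup1.
- exact: subgroup1.
- exact: subgroupM.
- exact: subgroupM.
- exact: subgroupV.
- exact: subgroupV.
Qed.

Lemma common_sub i : common `<=` Gs i.
Proof. by move=> x [? ?]; case: i. Qed.

Lemma coset_repP a : common (coset_rep a * a^-1).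
Proof.
rewrite /coset_rep; case: xgetP => [t -> //|/(_ a)] /=.
by rewrite mulgV => /(_ (subgroup1 subgroup_common)).
Qed.

Lemma coset_repMl h a : common h -> coset_rep (h * a) = coset_rep a.
Proof.
move=> h0; congr xget; apply/seteqP; split=> t /=; rewrite invgM mulgA.
  by apply: subgroupMr subgroup_common _; apply: subgroupV subgroup_common _.
by move=> ta; apply: subgroupM subgroup_common ta _;
  apply: subgroupV subgroup_common _.
Qed.

Lemma coset_rep_id a : coset_rep (coset_rep a) = coset_rep a.
Proof. by have := coset_repMl a (coset_repP a); rewrite !gnorm. Qed.

Lemma coset_rep_Gs i a : Gs i a -> Gs i (coset_rep a).
Proof.
move=> Ga; apply: (subgroupMr (sGs i) (subgroupV (sGs i) Ga)).
exact: common_sub (coset_repP a).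
Qed.

Lemma coset_rep_common a : common (coset_rep a) -> common a.
Proof.
move=> ca; rewrite -[a]invgK; apply: subgroupV subgroup_common _.
exact: subgroupMl subgroup_common ca (coset_repP a).
Qed.

Definition head_split (i : bool) (w : nform) : Prop :=
  [/\ Gs i w.1, syllables w.2 & head_type w <> Some i].

Lemma split_headP i w : normal w -> head_split i (split_head i w).
Proof.
case: w => h [|[j t] s] [/= h0]; first by split=> //; exact: common_sub.
case=> Gt nt tt sj ss; rewrite /split_head /=; case: eqP => [<-|/eqP ji].
  by split=> //=; apply: subgroupM => //; exact: common_sub.
by split=> //=; [exact: common_sub|case=> /eqP; rewrite (negPf ji)].
Qed.

Lemma join_headP i w : head_split i w -> normal (join_head i w).
Proof.
case: w => a s [/= Ga ss sh]; rewrite /join_head /=; case: asboolP => a0.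
  by split.
split=> /=.
  by rewrite -[_ * _]invgK invgM invgK; apply: subgroupV subgroup_common _;
    exact: coset_repP.
split=> //; first exact: coset_rep_Gs.
- by move=> /coset_rep_common.
- exact: coset_rep_id.
Qed.

Lemma join_headK i w : head_split i w -> split_head i (join_head i w) = w.
Proof.
case: w => a s [/= Ga ss sh]; rewrite /join_head /=; case: asboolP => a0.
  rewrite /split_head; case: s sh {ss} => [|[j t] s] //= sh.
  by case: eqP => // ji; case: sh; rewrite /head_type /= ji.
by rewrite /split_head /= eqxx !gnorm.
Qed.

Lemma split_headK i w : normal w -> join_head i (split_head i w) = w.
Proof.
case: w => h [|[j t] s] [/= h0 ss]; rewrite /join_head /split_head /=.
  by rewrite asboolT.
case: ss => Gt nt tt sj ss; case: eqP => [<-|_] /=; last by rewrite asboolT.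
rewrite asboolF; first by rewrite coset_repMl // tt !gnorm.
by move=> ht; apply: nt; apply: subgroupMl subgroup_common h0 ht.
Qed.

Lemma act_normal i a w : Gs i a -> normal w -> normal (act i a w).
Proof.
move=> Ga nw; apply: join_headP; have [Gw sw hw] := split_headP i nw.
by split=> //=; exact: subgroupM.
Qed.

Lemma actM i a b w :
  Gs i a -> Gs i b -> normal w -> act i (a * b) w = act i a (act i b w).
Proof.
move=> Ga Gb nw; rewrite /act join_headK /=; first by rewrite mulgA.
by have [Gw sw hw] := split_headP i nw; split=> //=; exact: subgroupM.
Qed.

Lemma act1 i w : normal w -> act i 1 w = w.
Proof.
by move=> nw; rewrite /act mul1g -[(_, _)]surjective_pairing split_headK.
Qed.

(** This agreement on the amalgamated subgroup is what lets the actions of the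
    two factors be glued. *)
Lemma act_common i j a w :
  common a -> normal w -> act i a w = act j a w.
Proof.
move=> a0; suff main k : normal w -> act k a w = (a * w.1, w.2).
  by move=> nw; rewrite !main.
case: w => h [|[l t] s] [/= h0 ss]; rewrite /act /join_head /split_head /=.
  by rewrite asboolT //; exact: subgroupM subgroup_common _ _.
case: ss => Gt nt tt sj ss; case: eqP => [<-|_] /=.
  rewrite asboolF; first by rewrite !coset_repMl // tt !gnorm.
  rewrite mulgA => aht; apply: nt; apply: subgroupMl subgroup_common _ aht.
  exact: subgroupM subgroup_common _ _.
by rewrite asboolT //; exact: subgroupM subgroup_common _ _.
Qed.

Lemma head_type_act i a w :
    Gs i a -> ~ common a -> normal w -> head_type w <> Some i ->
  head_type (act i a w) = Some i.
Proof.
move=> Ga na [w0 sw] hw; rewrite /act.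
have ->: split_head i w = w.
  case: w w0 sw hw => h [|[j t] s] //= _ _ hw; rewrite /split_head /=.
  by case: eqP => // ji; case: hw; rewrite /head_type /= ji.
rewrite /join_head asboolF //=.
by move=> aw; apply: na; apply: subgroupMr subgroup_common w0 aw.
Qed.

(** A syllable outside the amalgamated subgroup sends a normal form that does not
    start in its factor to one that does.  Following the trivial normal form
    along a reduced word therefore reveals the type of its first syllable. *)
Theorem ping_pong (alpha : G -> nform -> nform) :
    (forall x y w, normal w -> alpha (x * y) w = alpha x (alpha y w)) ->
    (forall i x w, normal w -> Gs i x -> alpha x w = act i x w) ->
  free_amalgam.
Proof.
move=> alphaM alphaE; pose w0 : nform := (1, [::]).
have nw0 : normal w0 by split=> //; exact: subgroup1 subgroup_common.
have red i x : reduced i x ->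
    normal (alpha x w0) /\ head_type (alpha x w0) = Some i.
  elim=> {i x} i s => [Gs_ ns|x Gs_ ns _ [nx hx]].
    rewrite (alphaE i) //; split; first exact: act_normal.
    exact: head_type_act.
  rewrite alphaM // (alphaE i) //; split; first exact: act_normal.
  by apply: head_type_act => //; rewrite hx; case: (i).
split=> // i x /red[_ hx]; last by move=> /red[_]; rewrite hx; case: (i).
move=> x0; move: hx; rewrite (alphaE true) //; last exact: common_sub.
rewrite /act /split_head /join_head /= asboolT ?mulg1 //.
Qed.

Corollary ping_pong_generated (A : bool -> set G)
    (alpha : G -> nform -> nform) :
    (forall i, Gs i = generated_subgroup (A i)) ->
    (forall x w, normal w -> normal (alpha x w)) ->
    (forall w, normal w -> alpha 1 w = w) ->
    (forall x y w, normal w -> alpha (x * y) w = alpha x (alpha y w)) ->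
    (forall i a w, normal w -> A i a -> alpha a w = act i a w) ->
  free_amalgam.
Proof.
move=> GsE alpha_n alpha1 alphaM alphaA; apply: (ping_pong alphaM) => i x w nw.
have AG a : A i a -> Gs i a by rewrite GsE; exact: mem_generated.
rewrite GsE => Ax; suff [] : Gs i x /\ alpha x w = act i x w by [].
move: x Ax; apply: generated_ind => [|a x Aa [Gx IH]|a x Aa [Gx IH]].
- by split; [exact: subgroup1|rewrite alpha1 // act1].
- have Ga := AG _ Aa; have nxw := alpha_n x w nw.
  by split; [exact: subgroupM|rewrite alphaM // (alphaA i) // IH actM].
have Ga := AG _ Aa; have Gav := subgroupV (sGs i) Ga.
split; first exact: subgroupM.
have nax : normal (alpha (a^-1 * x) w) by exact: alpha_n.
have := alphaM a (a^-1 * x) w nw; rewrite mulVKg IH (alphaA i) // => E.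
by rewrite actM // E -actM // mulVg act1.
Qed.

End NormalForms.

(** * Reduced words *)

Lemma eq_or_eq_negb (i j : bool) : j = ~~ i \/ j = i.
Proof. by case: i j => [] []; [right|left|left|right]. Qed.

Section ReducedCover.
Variables (G : groupType) (Gs : bool -> set G).
Hypothesis sGs : forall i, subgroup (Gs i).

Let sG0 : subgroup (common Gs) := subgroup_common sGs.

Lemma reduced_commonMl i c x :
  common Gs c -> reduced Gs i x -> reduced Gs i (c * x).
Proof.
move=> c0; have cG j : Gs j c := common_sub j c0.
have cN s : ~ common Gs s -> ~ common Gs (c * s).
  by move=> ns cs; apply: ns; exact: subgroupMl sG0 c0 cs.
elim=> {i x} [i s Gi ns|i s x Gi ns rx _]; last rewrite mulgA.
  by apply: reduced_syllable; [exact: subgroupM|exact: cN].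
by apply: reduced_cons => //; [exact: subgroupM|exact: cN].
Qed.

Lemma reduced_Ml i s x :
    Gs i s -> ~ common Gs s -> common Gs x \/ reduced Gs (~~ i) x ->
  reduced Gs i (s * x).
Proof.
move=> Gi ns [x0|rx]; last exact: reduced_cons.
apply: reduced_syllable; first exact: subgroupM (common_sub i x0).
by move=> sx; apply: ns; exact: subgroupMr sG0 x0 sx.
Qed.

Lemma reduced_cases i x : reduced Gs i x ->
  exists s y, [/\ Gs i s, ~ common Gs s, x = s * y
    & common Gs y \/ reduced Gs (~~ i) y].
Proof.
case=> {i x} [i s Gi ns|i s x Gi ns rx]; last by exists s, x; split=> //; right.
by exists s, 1; split=> //; [rewrite mulg1|left; exact: subgroup1].
Qed.

Lemma reduced_cover x :
    generated_subgroup (Gs true `|` Gs false) x ->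
  common Gs x \/ exists i, reduced Gs i x.
Proof.
have step i s y : Gs i s -> common Gs y \/ (exists j, reduced Gs j y) ->
    common Gs (s * y) \/ exists j, reduced Gs j (s * y).
  move=> Gi; have [s0 [y0|[j ry]]|ns] := EM (common Gs s).
  - by left; exact: subgroupM.
  - by right; exists j; exact: reduced_commonMl.
  case=> [y0|[j ry]]; first by right; exists i; apply: reduced_Ml; auto.
  have [ij|ij] := eq_or_eq_negb i j; rewrite {j}ij in ry.
    by right; exists i; apply: reduced_cons.
  have [t [z [Gt nt -> zP]]] := reduced_cases ry.
  rewrite mulgA; have [st|nst] := EM (common Gs (s * t)).
    case: zP => [z0|rz]; first by left; exact: subgroupM.
    by right; exists (~~ i); exact: reduced_commonMl.
  by right; exists i; apply: reduced_Ml => //; exact: subgroupM.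
apply: (@generated_ind _ _ [set x | common Gs x \/ exists i, reduced Gs i x])
  => [|a y []|a y []]; first by left; exact: subgroup1.
1,2: exact: step.
all: by move=> Ga; apply: step; exact: subgroupV (sGs _) Ga.
Qed.

End ReducedCover.

Section AmalgamTheory.
Variables (G : groupType) (Gs : bool -> set G).
Hypothesis amal : free_amalgam Gs.

Let sGs := amalgam_subgroup amal.
Let sG0 : subgroup (common Gs) := subgroup_common sGs.

(** In the tree, y turns the base edge around its end [Gs (~~ i)], and x moves all
    the edges at this end into the same branch.  The proof also needs what happens when y
    is in the factor in which x starts, since the types alternate along x. *)
Lemma reduced_Mr i x y :
  reduced Gs i x -> Gs (~~ i) y -> reduced Gs i (x * y).
Proof.
move=> rx; suff [] : (forall y, Gs (~~ i) y -> reduced Gs i (x * y)) /\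
  (forall y, Gs i y -> common Gs (x * y) \/ reduced Gs i (x * y)) by auto.
elim: rx => {i x y} [i s Gi ns|i s x Gi ns rx [IH1 IH2]]; split=> y Gy.
- have [y0|ny] := EM (common Gs y); first by apply: reduced_Ml; auto.
  by apply: reduced_cons => //; exact: reduced_syllable.
- have [sy|nsy] := EM (common Gs (s * y)); first by left.
  by right; apply: reduced_syllable => //; exact: subgroupM.
- by rewrite -mulgA; apply: reduced_Ml => //; exact: IH2.
- by right; rewrite -mulgA; apply: reduced_cons => //; apply: IH1;
    rewrite negbK.
Qed.

Lemma reduced_notin i x : reduced Gs i x -> ~ Gs (~~ i) x.
Proof.
move=> rx Gx; apply: (reduced_disjoint amal rx); apply: reduced_syllable => //.
exact: reduced_not_common amal _ _ rx.
Qed.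

(** If x fixes the base vertex of [Gs i] and its image under s * g, then it fixes
    the path between them; the first two edges of this path have stabilizers
    [common Gs] and its conjugate by s. *)
Lemma conj_syllable_common i s g x :
    Gs (~~ i) s -> ~ common Gs s -> common Gs g \/ reduced Gs i g ->
    Gs i x -> Gs i (x ^ (s * g)) ->
  common Gs x /\ common Gs (x ^ s).
Proof.
move=> Gs_ ns gP Gx Gxg.
have rsg : reduced Gs (~~ i) (s * g) by apply: reduced_Ml; rewrite ?negbK.
have x0 : common Gs x.
  apply: contrapT => nx; suff: reduced Gs (~~ i) (x * (s * g)).
    by apply: (reduced_disjoint amal); apply: reduced_cons.
  by rewrite conjgC; apply: reduced_Mr => //; rewrite negbK.
have Gxs : Gs (~~ i) (x ^ s) by apply: subgroupJ => //; exact: common_sub x0.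
split=> //; apply: contrapT => nxs.
have : reduced Gs (~~ i) (x ^ s * g) by apply: reduced_Ml; rewrite ?negbK.
rewrite conjgC -conjgM => rg.
case: gP => [g0|rg0].
  move: (reduced_notin rg); rewrite negbK; apply.
  by apply: subgroupM => //; exact: common_sub g0.
have [t [h [Gt nt gE [h0|rh]]]] := reduced_cases sGs rg0.
  move: (reduced_notin rg); rewrite negbK; apply; apply: subgroupM => //.
  by rewrite gE; apply: subgroupM => //; exact: common_sub h0.
apply: (reduced_disjoint amal rg).
rewrite negbK {1}gE -mulgA; apply: reduced_cons => //; apply: reduced_Mr => //.
by rewrite negbK.
Qed.

(** The subgroups [Hs i] of the two factors generate a subgroup H that is again
    an amalgam, and whose tree is therefore a subtree of the tree of [Gs]. *)
Section FixedSubtree.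
Variable Hs : bool -> set G.
Hypotheses (sHs : forall i, subgroup (Hs i)) (HsG : forall i, Hs i `<=` Gs i).
Hypothesis Hs_common : forall i x, Hs i x -> common Gs x -> common Hs x.

Definition subamalgam : set G := generated_subgroup (Hs true `|` Hs false).

Let H := subamalgam.

Let sH : subgroup H := subgroup_generated _.

Lemma subamalgam_sub i : Hs i `<=` H.
Proof. by move=> x Hx; apply: mem_generated; case: i Hx; [left|right]. Qed.

Lemma common_subamalgam x : common Hs x -> common Gs x.
Proof. by case=> h1 h2; split; exact: HsG. Qed.

Lemma reduced_subamalgam i x : reduced Hs i x -> reduced Gs i x.
Proof.
elim=> {i x} [i s Hi ns|i s x Hi ns _ rx].
  apply: reduced_syllable; first exact: HsG.
  by move/(Hs_common Hi).
apply: reduced_cons => //; first exact: HsG.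
by move/(Hs_common Hi).
Qed.

Definition left_coset_free i s :=
  ~ exists h c, [/\ Hs i h, common Gs c & s = h * c].
Definition right_coset_free i s :=
  ~ exists c h, [/\ common Gs c, Hs i h & s = c * h].

(** The element x moves the whole subtree of H into the branch starting in
    [Gs i] behind the base edge.  A reduced word whose last syllable cannot
    be absorbed into H describes this in a form suited to multiplication on the
    left. *)
Inductive away : bool -> set G :=
| away_syllable i s l of Gs i s & right_coset_free i s & H l : away i (s * l)
| away_cons i s x of Gs i s & ~ common Gs s & away (~~ i) x : away i (s * x).

Lemma left_coset_freeN i s : left_coset_free i s -> ~ common Gs s.
Proof.
by move=> fs s0; apply: fs; exists 1, s; split=> //;
  [exact: subgroup1|rewrite mul1g].
Qed.

Lemma right_coset_freeN i s : right_coset_free i s -> ~ common Gs s.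
Proof.
by move=> fs s0; apply: fs; exists s, 1; split=> //;
  [exact: subgroup1|rewrite mulg1].
Qed.

Lemma away_commonMl i c x : common Gs c -> away i x -> away i (c * x).
Proof.
move=> c0; have cG j : Gs j c := common_sub j c0.
case=> {i x} [i s l Gi fs Hl|i s x Gi ns ax]; rewrite mulgA.
  apply: away_syllable => //; first exact: subgroupM.
  move=> [d [h [d0 Hh csE]]]; apply: fs; exists (c^-1 * d), h.
  rewrite -mulgA -csE mulKg; split=> //.
  by apply: subgroupM => //; exact: subgroupV.
apply: away_cons => //; first exact: subgroupM.
by move=> cs; apply: ns; exact: subgroupMl sG0 c0 cs.
Qed.

Lemma away_reduced i x y : away i x -> H y -> reduced Gs i (x * y).
Proof.
move=> ax Hy.
elim: ax => {i x} [i s l Gi fs Hl|i s x Gi ns _ rx]; last first.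
  by rewrite -mulgA; apply: reduced_cons.
rewrite -mulgA; move: (l * y) (subgroupM sH Hl Hy) => {Hy Hl l}y Hy.
have nsh h : Hs i h -> ~ common Gs (s * h).
  move=> Hh sh; apply: fs; exists (s * h), h^-1; split=> //.
    exact: subgroupV.
  by rewrite mulgK.
have ns := right_coset_freeN fs.
have [y0|[j ry]] := reduced_cover sHs Hy.
  by apply: reduced_Ml => //; left; exact: common_subamalgam.
have [ij|ij] := eq_or_eq_negb i j; rewrite {j}ij in ry.
  by apply: reduced_cons => //; exact: reduced_subamalgam.
have [h [z [Hh nh -> zP]]] := reduced_cases sHs ry; rewrite mulgA.
apply: reduced_Ml => //; [|exact: nsh|].
  by apply: subgroupM => //; exact: HsG.
by case: zP; [left; exact: common_subamalgam|right; exact: reduced_subamalgam].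
Qed.

(** The two cases say whether the base edge belongs to the image of the subtree
    under g. *)
Lemma away_cover g :
    generated_subgroup (Gs true `|` Gs false) g ->
  (exists c l, [/\ common Gs c, H l & g = c * l]) \/ exists i, away i g.
Proof.
pose K g := (exists c l, [/\ common Gs c, H l & g = c * l]) \/
  exists i, away i g.
have syl i s l : Gs i s -> H l -> K (s * l).
  move=> Gi Hl; have [[c [h [c0 Hh ->]]]|fs] :=
      EM (exists c h, [/\ common Gs c, Hs i h & s = c * h]).
    left; exists c, (h * l); rewrite mulgA; split=> //.
    by apply: (subgroupM sH) => //; exact: subamalgam_sub Hh.
  by right; exists i; exact: away_syllable.
have step i s y : Gs i s -> K y -> K (s * y).
  move=> Gi [[c [l [c0 Hl ->]]]|[j ay]].
    rewrite mulgA; apply: (syl i) => //; apply: subgroupM => //.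
    exact: common_sub c0.
  have [s0|ns] := EM (common Gs s).
    by right; exists j; exact: away_commonMl.
  have [ij|ij] := eq_or_eq_negb i j; rewrite {j}ij in ay.
    by right; exists i; apply: away_cons.
  case: ay => {y} [j t l Gt ft Hl|j t x Gt nt ax] in Gi *; rewrite mulgA.
    by apply: (syl j) => //; exact: subgroupM.
  have [st|nst] := EM (common Gs (s * t)).
    by right; exists (~~ j); exact: away_commonMl.
  by right; exists j; apply: away_cons => //; exact: subgroupM.
move: g; apply: (@generated_ind _ _ K) => [|a y []|a y []].
- by left; exists 1, 1; rewrite mulg1; split=> //; exact: subgroup1.
1,2: exact: step.
all: by move=> Ga; apply: step; exact: subgroupV (sGs _) Ga.
Qed.

(** Here the bridge from the subtree of H to its image under s * d starts at the
    base vertex of [Gs i] and leaves the subtree at once, by the edge of s.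
    Since y preserves both subtrees, it fixes that vertex. *)
Lemma away_intertwine i s d y z :
    Gs i s -> left_coset_free i s -> away (~~ i) d -> H y -> H z ->
    y * (s * d) = (s * d) * z ->
  Hs i y.
Proof.
move=> Gi fs ad Hy Hz ysd.
have rd : reduced Gs (~~ i) d by have := away_reduced ad (subgroup1 sH);
  rewrite mulg1.
have rdz := away_reduced ad Hz.
have hsN h : Hs i h -> ~ common Gs (h * s).
  move=> Hh hs; apply: fs; exists h^-1, (h * s); split=> //.
    exact: subgroupV.
  by rewrite mulKg.
have ns := left_coset_freeN fs.
have rsd h : Hs i h -> reduced Gs i (h * (s * d)).
  move=> Hh; rewrite mulgA; apply: reduced_cons; [|exact: hsN|by []].
  by apply: subgroupM => //; exact: HsG.
have rsd1 : reduced Gs i (s * d) by apply: reduced_cons.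
(* Unless y is in [Hs i], the product y * (s * d) starts with a syllable of y;
   comparing with s * d * z, which starts with s, contradicts that s is not in
   [Hs i] * [common Gs]. *)
have push j x : reduced Hs j x ->
    (j = ~~ i -> reduced Gs j (x * (s * d))) /\
    (j = i -> ~ Hs i x -> exists h, [/\ Hs i h, ~ common Gs h
        & reduced Gs (~~ i) (h^-1 * (x * (s * d)))]).
  elim=> {j x} [j h Hj nh|j h x Hj nh rx [IH1 IH2]].
    have nh' : ~ common Gs h by move/(Hs_common Hj).
    split=> ji; last by rewrite -ji => /(_ Hj).
    by apply: reduced_cons; rewrite ?ji ?negbK // -ji; exact: HsG.
  have nh' : ~ common Gs h by move/(Hs_common Hj).
  split=> ji.
    rewrite -mulgA; apply: reduced_cons => //; first exact: HsG.
    rewrite ji negbK; have [Hx|nHx] := EM (Hs i x); first exact: rsd.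
    have [|k [Hk nk rk]] := IH2 _ nHx; first by rewrite ji negbK.
    by rewrite -[_ * _](mulVKg k); apply: reduced_cons => //; exact: HsG.
  move=> _; exists h; split=> //; first by rewrite -ji.
  by rewrite -mulgA mulKg -{1}ji; apply: IH1; rewrite ji.
have rsdy : reduced Gs i (y * (s * d)).
  by rewrite ysd -mulgA; apply: reduced_cons.
have [[y1 y2]|[j ry]] := reduced_cover sHs Hy; first by case: (i).
have [push1 push2] := push _ _ ry.
have [ij|ij] := eq_or_eq_negb i j.
  have := push1 ij; rewrite ij => r2.
  by case: (reduced_disjoint amal rsdy r2).
apply: contrapT => nHy; have [h [Hh nh]] := push2 ij nHy.
rewrite ysd -(mulgA s) (mulgA h^-1) => rh.
apply: (reduced_disjoint amal rh); rewrite negbK; apply: reduced_cons => //.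
  by apply: subgroupM => //; apply: subgroupV => //; exact: HsG.
apply: hsN; exact: subgroupV.
Qed.

(** Either the subtree of H meets its image under g, or there is a bridge between
    them, starting at the vertex l * [Gs i]. *)
Lemma double_coset_or_away g :
    generated_subgroup (Gs true `|` Gs false) g ->
  (exists i l a l', [/\ H l, H l', Gs i a & g = l * a * l']) \/
  (exists l i, H l /\ forall x, H x -> commute x g -> Hs i (x ^ l)).
Proof.
move=> /away_cover [[c [l [c0 Hl ->]]]|[i ag]].
  left; exists true, 1, c, l; rewrite mul1g; split=> //; first exact: subgroup1.
  exact: common_sub c0.
have main : forall c, common Gs c ->
    (exists i l a l', [/\ H l, H l', Gs i a & c * g = l * a * l']) \/
    (exists l i s d, [/\ H l, Gs i s, left_coset_free i s, away (~~ i) d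
        & c * g = l * s * d]).
  elim: ag => {i g} [i s l Gi fs Hl|i s x Gi ns ax IH] c c0.
    left; exists i, 1, (c * s), l; rewrite mul1g mulgA; split=> //.
      exact: subgroup1.
    by apply: subgroupM => //; exact: common_sub c0.
  have [[h [c' [Hh c'0 csE]]]|fs] :=
      EM (exists h c', [/\ Hs i h, common Gs c' & c * s = h * c']).
    have Hh' := subamalgam_sub Hh.
    have [[j [l [a [l' [Hl Hl' Ga E]]]]]|[l [j [t [d [Hl Gt ft ad E]]]]]] :=
        IH _ c'0.
      left; exists j, (h * l), a, l'; split=> //; first exact: (subgroupM sH).
      by rewrite mulgA csE -mulgA E !mulgA.
    right; exists (h * l), j, t, d; split=> //; first exact: (subgroupM sH).
    by rewrite mulgA csE -mulgA E !mulgA.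
  right; exists 1, i, (c * s), x; rewrite mul1g mulgA; split=> //.
    exact: subgroup1.
  by apply: subgroupM => //; exact: common_sub c0.
have [|[l [j [s [d [Hl Gj fs ad]]]]]] := main 1 (subgroup1 sG0);
  rewrite mul1g; first by left.
move=> gE; right; exists l, j; split=> // x Hx xg.
apply: (away_intertwine (z := x) Gj fs ad) => //; first exact: (subgroupJ sH).
have ->: s * d = l^-1 * g by rewrite gE -mulgA mulKg.
by rewrite conjgE -!mulgA mulVKg xg.
Qed.

(** If a fixes the base vertex of [Gs i] but no edge of the subtree at that
    vertex, then this vertex is the only fixed point of a in the subtree, and
    whatever commutes with a fixes it. *)
Lemma centralizer_elliptic i a y :
    Gs i a -> (forall h, Hs i h -> ~ common Gs (a ^ h)) -> H y ->
    commute y a ->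
  Hs i y.
Proof.
move=> Ga aN Hy ya.
have key l z : Hs i l -> reduced Hs (~~ i) z -> y <> l * z.
  move=> Hl rz yE; have rz' := reduced_subamalgam rz.
  have bz : a ^ l * z = z * a.
    by rewrite conjgE -!mulgA -yE -ya yE -mulgA mulKg.
  have: reduced Gs i (a ^ l * z).
    apply: reduced_cons => //; last exact: aN.
    by apply: subgroupJ => //; exact: HsG.
  rewrite bz => /(reduced_disjoint amal); apply.
  by apply: reduced_Mr => //; rewrite negbK.
have [[y1 y2]|[j ry]] := reduced_cover sHs Hy; first by case: (i).
have [ij|ij] := eq_or_eq_negb i j; rewrite {j}ij in ry.
  case: (key 1 y) => //; last by rewrite mul1g.
  exact: subgroup1.
have [h [z [Hh nh yE [z0|rz]]]] := reduced_cases sHs ry.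
  by rewrite yE; apply: subgroupM => //; exact: common_sub z0.
by case: (key h z).
Qed.

(** The hypothesis bounds the fixed points of t in the subtree of H: along a path
    from the base vertex of [Gs i], they go no further than the neighbours.
    Hence the base vertex is its only translate fixed by t. *)
Lemma centralizer_common i t y :
    common Gs t ->
    (forall l h, Hs i l -> Hs (~~ i) h -> common Gs (t ^ l) ->
      common Gs (t ^ (l * h)) -> common Hs h) ->
    H y -> commute y t ->
  Hs i y.
Proof.
move=> t0 tN Hy yt.
have tG j : Gs j t := common_sub j t0.
have key l z : Hs i l -> reduced Hs (~~ i) z -> y <> l * z.
  move=> Hl rz yE; have rz' := reduced_subamalgam rz.
  have bz : t ^ l * z = z * t.
    by rewrite conjgE -!mulgA -yE -yt yE -mulgA mulKg.
  have tl0 : common Gs (t ^ l).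
    apply: contrapT => ntl.
    have: reduced Gs i (t ^ l * z).
      by apply: reduced_cons => //; apply: subgroupJ => //; exact: HsG.
    rewrite bz => /(reduced_disjoint amal); apply; exact: reduced_Mr.
  have [h [x [Hh nh zE xP]]] := reduced_cases sHs rz.
  apply: nh; apply: (tN l) => //.
  have bx : t ^ (l * h) * x = x * t.
    apply: (mulgI (l * h)); rewrite mulgA -conjgC -!mulgA -zE -yE -yt yE zE.
    by rewrite !mulgA.
  case: xP => [x0|rx].
    rewrite -[_ ^ _](mulgK x) bx; apply: subgroupM => //.
      by apply: subgroupM => //; exact: common_subamalgam.
    by apply: subgroupV => //; exact: common_subamalgam.
  apply: contrapT => ntlh.
  have rx' := reduced_subamalgam rx; rewrite negbK in rx'.
  have: reduced Gs (~~ i) (t ^ (l * h) * x).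
    apply: reduced_cons; rewrite ?negbK //; rewrite conjgM.
    by apply: subgroupJ => //; [exact: common_sub tl0|exact: HsG].
  by rewrite bx; apply: (reduced_disjoint amal); exact: reduced_Mr.
have [[y1 y2]|[j ry]] := reduced_cover sHs Hy; first by case: (i).
have [ij|ij] := eq_or_eq_negb i j; rewrite {j}ij in ry.
  case: (key 1 y) => //; last by rewrite mul1g.
  exact: subgroup1.
have [h [z [Hh nh yE [z0|rz]]]] := reduced_cases sHs ry.
  by rewrite yE; apply: subgroupM => //; exact: common_sub z0.
by case: (key h z).
Qed.

End FixedSubtree.
End AmalgamTheory.

(** * Actions of presented groups *)

(** The identities for an action are only required on the invariant part [ok]:
    the maps by which an amalgam acts on its normal forms are defined, but
    meaningless, on pairs that are not normal. *)
Section WordAction.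
Variables (V : choiceType) (R : word V -> word V -> Prop).
Variables (T : Type) (ok : T -> Prop) (f : V * bool -> T -> T).

Definition word_act (w : word V) (t : T) : T := foldr f t w.

Definition group_act (x : presented_group R) : T -> T := word_act (repr x).

Lemma word_act_cat w1 w2 t :
  word_act (w1 ++ w2) t = word_act w1 (word_act w2 t).
Proof. exact: foldr_cat. Qed.

Hypothesis f_ok : forall a t, ok t -> ok (f a t).
Hypothesis f_cancel : forall v b t, ok t -> f (v, b) (f (v, ~~ b) t) = t.
Hypothesis f_rel :
  forall l r t, R l r -> ok t -> word_act l t = word_act r t.

Lemma word_act_ok w t : ok t -> ok (word_act w t).
Proof. by move=> okt; elim: w => //= a w; exact: f_ok. Qed.

Lemma word_act_eq w1 w2 t :
  word_eq R w1 w2 -> ok t -> word_act w1 t = word_act w2 t.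
Proof.
move=> E; elim: E t => {w1 w2} [//|w1 w2 _ IH t|w1 w2 w3 _ IH1 _ IH2 t
  |p q v b t|p q l r Rlr t] okt.
- by rewrite IH.
- by rewrite IH1 // IH2.
- by rewrite !word_act_cat /= f_cancel //; exact: word_act_ok.
- by rewrite !word_act_cat (f_rel Rlr) //; exact: word_act_ok.
Qed.

Lemma group_act_word w t : ok t -> group_act (of_word R w) t = word_act w t.
Proof. exact/word_act_eq/repr_of_word. Qed.

Lemma group_actM x y t :
  ok t -> group_act (x * y) t = group_act x (group_act y t).
Proof. by move=> okt; rewrite group_act_word // word_act_cat. Qed.

Lemma group_act_gen v t : ok t -> group_act (gen R v) t = f (v, true) t.
Proof. exact: group_act_word. Qed.

End WordAction.

Section Letters.
Variables (V : choiceType) (R : word V -> word V -> Prop).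

Definition letter (a : V * bool) : presented_group R :=
  if a.2 then gen R a.1 else (gen R a.1)^-1.

Lemma of_word_cat w1 w2 : of_word R (w1 ++ w2) = of_word R w1 * of_word R w2.
Proof. by rewrite -of_wordM. Qed.

Lemma of_word1 a : of_word R [:: a] = letter a.
Proof.
case: a => v [] //; rewrite /letter /=.
apply: (mulgI (gen R v)); rewrite mulgV -of_word_cat.
by apply/of_wordP; exact: (word_eq_cancel R [::] [::] v true).
Qed.

Lemma of_word_cons a w : of_word R (a :: w) = letter a * of_word R w.
Proof. by rewrite -of_word1 -of_word_cat. Qed.

Lemma letterN v b : letter (v, ~~ b) = (letter (v, b))^-1.
Proof. by case: b; rewrite /letter /= ?invgK. Qed.

Lemma presented_ind (P : presented_group R -> Prop) :
  (forall w, P (of_word R w)) -> forall x, P x.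
Proof. by move=> Pw x; rewrite -[x]reprK; exact: Pw. Qed.

End Letters.

(** * Retractions onto standard parabolic subgroups *)

Section Retractions.
Variables (V : finType) (Gamma : artin_graph V).
Hypothesis Gamma_even : even_graph Gamma.

Local Notation G := (artin_group Gamma).
Local Notation R := (artin_rel Gamma).
Local Notation e := (artin_gen Gamma).
Local Notation par S := (@standard_parabolic V Gamma (mem (S : {set V}))).
Implicit Types (A B S T : {set V}) (x y g : G).

Lemma label_double (u v : V) : edge Gamma u v ->
  label Gamma u v = (label Gamma u v)./2.*2.
Proof. by move=> uv; rewrite even_halfK //; exact: Gamma_even. Qed.

Lemma prod_word_double (W : choiceType) (u v : W) k :
  prod_word u v k.*2 = flatten (nseq k [:: u; v]).
Proof. by elim: k => //= k ->. Qed.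

Definition restrict_word S (w : word V) : word V :=
  [seq a <- w | a.1 \in S].

(** Deleting one of the two letters from a relation of even length leaves the
    same power of the other letter on both sides. *)
Lemma restrict_rel S l r : R l r ->
  restrict_word S l = restrict_word S r \/
  restrict_word S l = l /\ restrict_word S r = r.
Proof.
case=> u v uv; rewrite label_double // !prod_word_double.
set k := _./2.
have res a b : restrict_word S (pos_word (flatten (nseq k [:: a; b]))) =
  pos_word (flatten (nseq k (filter (mem S) [:: a; b]))).
  by rewrite /restrict_word filter_map filter_flatten map_nseq.
rewrite !res /=; case: (u \in S); case: (v \in S); [right|left|left|left];
  by [].
Qed.

Lemma restrict_word_eq S w1 w2 : word_eq R w1 w2 ->
  word_eq R (restrict_word S w1) (restrict_word S w2).
Proof.
elim=> {w1 w2} [w|w1 w2 _ h|w1 w2 w3 _ h1 _ h2|p q v b|p q l r lr].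
- exact: word_eq_refl.
- exact: word_eq_sym.
- exact: word_eq_trans h2.
- rewrite /restrict_word !filter_cat /=; case: (v \in S).
    exact: word_eq_cancel.
  exact: word_eq_refl.
- rewrite /restrict_word !filter_cat.
  have [|[]] := restrict_rel S lr; rewrite /restrict_word => -> //.
    exact: word_eq_refl.
  by move->; exact: word_eq_rel.
Qed.

Definition ret S x : G := of_word R (restrict_word S (repr x)).

Lemma ret_word S w : ret S (of_word R w) = of_word R (restrict_word S w).
Proof. by apply/of_wordP/restrict_word_eq/repr_of_word. Qed.

Lemma retM S : {morph ret S : x y / x * y}.
Proof.
elim/presented_ind=> w1; elim/presented_ind=> w2.
by rewrite -of_word_cat !ret_word /restrict_word filter_cat of_word_cat.
Qed.

Lemma ret1 S : ret S 1 = 1.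
Proof. exact: (ret_word S [::]). Qed.

Lemma retV S : {morph ret S : x / x^-1}.
Proof. by move=> x; apply: (mulgI (ret S x)); rewrite -retM !mulgV ret1. Qed.

Lemma retJ S x y : ret S (x ^ y) = ret S x ^ ret S y.
Proof. by rewrite !conjgE !retM retV. Qed.

Lemma ret_ret S T x : ret S (ret T x) = ret (S :&: T) x.
Proof.
elim/presented_ind: x => w; rewrite !ret_word /restrict_word -filter_predI.
by congr of_word; apply: eq_filter => a /=; rewrite inE.
Qed.

Lemma ret_gen S v : ret S (e v) = if v \in S then e v else 1.
Proof.
rewrite [LHS](ret_word S [:: (v, true)]) /restrict_word /=.
by case: (v \in S).
Qed.

Lemma subgroup_par S : subgroup (par S).
Proof. exact: subgroup_generated. Qed.

Lemma par_gen S v : v \in S -> par S (e v).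
Proof. by move=> vS; apply: mem_generated; exists v. Qed.

Lemma ret_par S x : par S (ret S x).
Proof.
elim/presented_ind: x => w; rewrite ret_word.
elim: w => [|[v b] w IH] /=; first exact: subgroup1 (subgroup_par S).
case: ifP => // vS; rewrite of_word_cons.
apply: (subgroupM (subgroup_par S) _ IH).
rewrite /letter; case: b => /=; first exact: par_gen.
by apply: (subgroupV (subgroup_par S)); exact: par_gen.
Qed.

Lemma ret_id S x : par S x -> ret S x = x.
Proof.
move: x; apply: generated_sub.
  split=> [|x y|x] /=; first exact: ret1.
    by rewrite retM => -> ->.
  by rewrite retV => ->.
by move=> _ [v vS <-] /=; rewrite ret_gen vS.
Qed.

(** Standard parabolics are the fixed sets of the retractions, which makes their
    intersections computable. *)
Lemma parP S x : par S x <-> ret S x = x.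
Proof. by split=> [|<-]; [exact: ret_id|exact: ret_par]. Qed.

Lemma ret_capl A B x : par A x -> par (B :&: A) (ret B x).
Proof. by move=> /ret_id <-; rewrite ret_ret; exact: ret_par. Qed.

Lemma parS A B : A \subset B -> par A `<=` par B.
Proof.
move=> /finset.setIidPr AB x /parP Ax; apply/parP.
by rewrite -{1}Ax ret_ret AB.
Qed.

Lemma ret_mono A B x : A \subset B -> ret A (ret B x) = ret A x.
Proof. by move=> /finset.setIidPl AB; rewrite ret_ret AB. Qed.

Lemma parI A B x : par A x -> par B x -> par (A :&: B) x.
Proof. by move=> /ret_id xA xB; rewrite -xA; exact: ret_capl. Qed.

Lemma par0 x : par finset.set0 x -> x = 1.
Proof.
move: x; apply: generated_ind => // a x [v]; by rewrite /= inE.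
Qed.

Lemma parT x : par [set: V]%SET x.
Proof.
apply/parP; elim/presented_ind: x => w; rewrite ret_word; congr of_word.
by apply/all_filterP/allP => a _; rewrite inE.
Qed.

Lemma ret_disjoint A B x : A :&: B = finset.set0 -> par A x -> ret B x = 1.
Proof.
rewrite finset.setIC => AB Ax; apply: par0; rewrite -AB.
exact: ret_capl.
Qed.

Lemma par_generatedU A B :
  generated_subgroup (par A `|` par B) = par (A :|: B).
Proof.
apply/seteqP; split=> x.
  move: x; apply: generated_sub => [|x]; first exact: subgroup_par.
  by case; apply: parS; [exact: finset.subsetUl|exact: finset.subsetUr].
move: x; apply: generated_sub; first exact: subgroup_generated.
move=> _ [v + <-]; rewrite /= inE => /orP[] vS; apply: mem_generated.
  by left; exact: par_gen.
by right; exact: par_gen.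
Qed.

Lemma commute_par A B x y :
    (forall a b, a \in A -> b \in B -> commute (e a) (e b)) ->
  par A x -> par B y -> commute x y.
Proof.
move=> AB Ax By.
have cA b : b \in B -> commute x (e b).
  move=> bB; move: x Ax; apply: generated_sub; first exact: subgroup_commute.
  by move=> _ [a aA <-]; exact: AB.
apply: commute_sym; move: y By; apply: generated_sub.
  exact: subgroup_commute.
by move=> _ [b bB <-]; apply/commute_sym/cA.
Qed.

(** Commuting disjoint sets of generators give a direct product, with the
    retractions as projections. *)
Lemma par_prod A B x :
    A :&: B = finset.set0 ->
    (forall a b, a \in A -> b \in B -> commute (e a) (e b)) ->
  par (A :|: B) x -> x = ret A x * ret B x.
Proof.
move=> AB0 AB; rewrite -par_generatedU; move: x.
have BA0 : B :&: A = finset.set0 by rewrite finset.setIC.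
have cAB x y : par A x -> par B y -> commute x y by exact: commute_par.
have PA a x : par A a -> x = ret A x * ret B x ->
    a * x = ret A (a * x) * ret B (a * x).
  move=> Aa {1}->; rewrite !retM (ret_id Aa) (ret_disjoint AB0 Aa).
  by rewrite mul1g mulgA.
have PB b x : par B b -> x = ret A x * ret B x ->
    b * x = ret A (b * x) * ret B (b * x).
  move=> Bb {1}->; rewrite !retM (ret_id Bb) (ret_disjoint BA0 Bb) mul1g !mulgA.
  by rewrite (cAB (ret A x) b) //; exact: ret_par.
apply: generated_ind => [|a x []|a x []]; first by rewrite !ret1 mulg1.
- exact: PA.
- exact: PB.
- by move=> Aa; apply: PA; exact: (subgroupV (subgroup_par A)).
- by move=> Aa; apply: PB; exact: (subgroupV (subgroup_par B)).
Qed.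

Lemma of_word_double u v k :
  of_word R (pos_word (prod_word u v k.*2)) = (e u * e v) ^+ k.
Proof.
rewrite prod_word_double; elim: k => // k IH.
rewrite expgS -IH -[nseq k.+1 _]/(_ :: _) /= [LHS]of_word_cons.
by rewrite [X in _ * X]of_word_cons mulgA.
Qed.

Lemma artin_relation u v : edge Gamma u v ->
  (e u * e v) ^+ (label Gamma u v)./2 = (e v * e u) ^+ (label Gamma u v)./2.
Proof.
move=> uv; rewrite -!of_word_double -label_double //.
have := @word_eq_rel _ R [::] [::] _ _ (ArtinRel uv); rewrite !cats0 /=.
by move/of_wordP.
Qed.

Lemma commute_label2 u v : edge Gamma u v -> label Gamma u v = 2 ->
  commute (e u) (e v).
Proof. by move=> uv l2; have := artin_relation uv; rewrite l2 !expg1. Qed.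

End Retractions.

(** * Exponent sums *)

Section ExponentSum.
Variables (V : finType) (Gamma : artin_graph V).
Hypothesis Gamma_even : even_graph Gamma.

Local Notation G := (artin_group Gamma).
Local Notation R := (artin_rel Gamma).
Local Notation e := (artin_gen Gamma).
Local Notation par S := (@standard_parabolic V Gamma (mem (S : {set V}))).

Definition weight (u : V) (a : V * bool) : int :=
  if a.1 == u then (if a.2 then 1 else -1)%R else 0%R.

(** The homomorphism to the integers that counts u with signs, obtained by
    letting the group act on the integers by translations. *)
Definition expo (u : V) (x : G) : int :=
  group_act (fun a t => weight u a + t)%R x 0%R.

Let f u := (fun a t => weight u a + t)%R.

Let f_cancel u v b (t : int) : True -> f u (v, b) (f u (v, ~~ b) t) = t.
Proof. by rewrite /f /weight /=; case: (v == u) b => [] [] /= _; lia. Qed.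

Let word_act_shift u w t : word_act (f u) w t = (word_act (f u) w 0 + t)%R.
Proof. by elim: w => /= [|a w IH]; rewrite /f; [|rewrite IH /f]; lia. Qed.

Let f_rel u l r t : R l r -> True -> word_act (f u) l t = word_act (f u) r t.
Proof.
move=> lr _; rewrite word_act_shift [RHS]word_act_shift; congr (_ + t)%R.
case: lr => a b ab; rewrite label_double // !prod_word_double.
set k := _./2; elim: k => //= k IH; rewrite /f /= in IH *.
by rewrite -/(pos_word _) IH; lia.
Qed.

Lemma expo_word u w : expo u (of_word R w) = word_act (f u) w 0%R.
Proof.
apply: (@group_act_word _ _ _ (fun=> True)) => // [v b t|l r t].
  exact: f_cancel.
exact: f_rel.
Qed.

Lemma expoM u x y : expo u (x * y) = (expo u x + expo u y)%R.
Proof.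
elim/presented_ind: x => w1; elim/presented_ind: y => w2.
by rewrite -of_word_cat !expo_word word_act_cat word_act_shift.
Qed.

Lemma expo1 u : expo u 1 = 0%R.
Proof. by rewrite [LHS](expo_word u [::]). Qed.

Lemma expoV u x : expo u x^-1 = (- expo u x)%R.
Proof. by have := expoM u x x^-1; rewrite mulgV expo1; lia. Qed.

Lemma expoX u x n : expo u (x ^+ n) = (expo u x *+ n)%R.
Proof.
elim: n => [|n IH]; first by rewrite expo1.
by rewrite expgS expoM IH GRing.mulrS.
Qed.

Lemma expo_gen u v : expo u (e v) = (v == u)%:Z%R.
Proof.
by rewrite [LHS](expo_word u [:: (v, true)]) /= /f /weight /=; case: (v == u).
Qed.

End ExponentSum.

(** * Splitting along a separating set of generators *)

Section Amalgams.
Variables (V : finType) (Gamma : artin_graph V).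
Hypothesis Gamma_even : even_graph Gamma.

Local Notation G := (artin_group Gamma).
Local Notation R := (artin_rel Gamma).
Local Notation e := (artin_gen Gamma).
Local Notation par S := (@standard_parabolic V Gamma (mem (S : {set V}))).

Lemma act_inv (Gs : bool -> set G) i a w :
    (forall j, subgroup (Gs j)) -> Gs i a -> normal Gs w ->
  act Gs i a (act Gs i a^-1 w) = w.
Proof.
move=> sGs Ga nw; rewrite -actM ?mulgV ?act1 //.
exact: subgroupV.
Qed.

Lemma act_invV (Gs : bool -> set G) i a w :
    (forall j, subgroup (Gs j)) -> Gs i a -> normal Gs w ->
  act Gs i a^-1 (act Gs i a w) = w.
Proof.
move=> sGs Ga nw; rewrite -actM ?mulVg ?act1 //.
exact: subgroupV.
Qed.

Section Separation.
Variables S1 S2 : {set V}.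
Hypothesis separated : forall a b, a \in S1 -> b \in S2 -> edge Gamma a b ->
  a \in S2 \/ b \in S1.

Let side (i : bool) := if i then S1 else S2.
Let Gs (i : bool) : set G := par (side i).

Let sGs i : subgroup (Gs i).
Proof. exact: subgroup_par. Qed.

(** Generators outside both sets act trivially.  The relations that involve them
    are respected for the same reason as for retractions, so that the splitting
    is obtained for the subgroup on S1 and S2 from an action of the whole
    group. *)
Let f (a : V * bool) (w : nform G) : nform G :=
  if a.1 \in S1 then act Gs true (letter R a) w
  else if a.1 \in S2 then act Gs false (letter R a) w else w.

Let Gs_letter i a : a.1 \in side i -> Gs i (letter R a).
Proof.
move=> aS; rewrite /letter; case: a.2; first exact: par_gen.
by apply: (subgroupV (sGs i)); exact: par_gen.
Qed.

Let f_ok a w : normal Gs w -> normal Gs (f a w).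
Proof.
move=> nw; rewrite /f; case: ifP => [a1|_].
  by apply: act_normal => //; exact: (Gs_letter (i := true)).
case: ifP => // a2.
by apply: act_normal => //; exact: (Gs_letter (i := false)).
Qed.

Let f_cancel v b w : normal Gs w -> f (v, b) (f (v, ~~ b) w) = w.
Proof.
move=> nw; rewrite /f /= letterN.
case v1: (v \in S1).
  by apply: act_inv => //; exact: (Gs_letter (i := true)).
case v2: (v \in S2) => //.
by apply: act_inv => //; exact: (Gs_letter (i := false)).
Qed.

Let word_act_side i w t :
    (forall a, a \in w -> a.1 \in S1 :|: S2 -> a.1 \in side i) ->
    normal Gs t ->
  word_act f w t = act Gs i (ret (side i) (of_word R w)) t.
Proof.
move=> ws nt; elim: w ws => [_|a w IH ws] /=.
  by rewrite ret_word //= act1.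
have {}IH := IH (fun b bw => ws b (@mem_behead _ (a :: w) b bw)).
have {ws} := ws a (mem_head _ _); rewrite inE => aS.
rewrite ret_word // /restrict_word /= -/(restrict_word _ w).
rewrite IH /f.
have Gw : Gs i (ret (side i) (of_word R w)) by exact: ret_par.
have nw := act_normal sGs Gw nt.
case: ifP => [a1|aN1].
  rewrite aS ?a1 // of_word_cons -ret_word // actM //; last first.
    by apply: Gs_letter; rewrite aS ?a1.
  case: {IH Gw} i aS nw => // aS nw; apply: act_common => //; split.
    exact: (Gs_letter (i := true)).
  by apply: (Gs_letter (i := false)); rewrite aS ?a1.
case: ifP => a2; last first.
  case: ifP; last by rewrite -ret_word.
  by case: (i); rewrite /side ?aN1 ?a2.
rewrite aS ?a2 ?orbT // of_word_cons -ret_word // actM //; last first.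
  by apply: Gs_letter; rewrite aS ?a2 ?orbT.
case: {IH Gw} i aS nw => // aS nw.
by move: aS; rewrite /side aN1 a2 => /(_ isT).
Qed.

(** When no edge joins the two complements, every relation lives in one of the
    two factors, apart from generators that act trivially. *)
Lemma separation_amalgam :
  free_amalgam (fun i => par (if i then S1 else S2)).
Proof.
have f_rel l r t : R l r -> normal Gs t -> word_act f l t = word_act f r t.
  move=> lr nt.
  suff [i li ri] : exists2 i,
      (forall a, a \in l -> a.1 \in S1 :|: S2 -> a.1 \in side i)
    & (forall a, a \in r -> a.1 \in S1 :|: S2 -> a.1 \in side i).
    rewrite (word_act_side li) // (word_act_side ri) //.
    congr (act _ _ (ret _ _) _).
    have := @word_eq_rel _ R [::] [::] _ _ lr; rewrite !cats0 /=.
    by move/of_wordP.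
  case: lr => u v uv.
  have mem a b n : forall c, c \in pos_word (prod_word a b n) ->
      (c.1 == a) || (c.1 == b).
    move=> c /mapP[x + ->] /=; elim: n a b => //= n IH a b.
    by rewrite inE => /orP[-> //|/IH]; rewrite orbC.
  suff [i iu iv] : exists2 i, (u \in S1 :|: S2 -> u \in side i)
      & (v \in S1 :|: S2 -> v \in side i).
    by exists i => a /mem /orP[] /eqP ->.
  have uv' := uv; rewrite edge_sym in uv'.
  have := separated (a := u) (b := v); have := separated (a := v) (b := u).
  rewrite !inE; case u1: (u \in S1); case v1: (v \in S1) => /=.
  - by exists true; rewrite /= ?u1 ?v1.
  - case v2: (v \in S2) => s1 s2; last by exists true; rewrite /= ?u1 ?v1 ?v2.
    by case: (s2 isT isT uv) => // u2; exists false; rewrite /= ?v2.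
  - case u2: (u \in S2) => s1 s2; last by exists true; rewrite /= ?u1 ?v1 ?u2.
    by case: (s1 isT isT uv') => // v2; exists false; rewrite /= ?u2.
  - by exists false.
apply: (ping_pong_generated sGs (alpha := group_act f)
  (A := fun i => [set e v | v in [set v | v \in side i]])) => //.
- by move=> x w nw; exact: word_act_ok.
- by move=> w nw; rewrite (group_act_word (ok := normal Gs) _ _ _ [::]).
- by move=> x y w nw; exact: (group_actM f_ok f_cancel f_rel).
- move=> i _ w nw [v /= vi <-].
  rewrite (group_act_gen f_ok f_cancel f_rel) //.
  rewrite -[f _ w]/(word_act f [:: (v, true)] w) (word_act_side (i := i)) //.
    by rewrite [of_word _ _]of_word1 ret_gen // vi.
  by move=> a; rewrite inE => /eqP ->.
Qed.

End Separation.
End Amalgams.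

(** * Dihedral Artin groups *)

Section Dihedral.
Variables (V : finType) (Gamma : artin_graph V).
Hypothesis Gamma_even : even_graph Gamma.

Local Notation G := (artin_group Gamma).
Local Notation R := (artin_rel Gamma).
Local Notation e := (artin_gen Gamma).
Local Notation par S := (@standard_parabolic V Gamma (mem (S : {set V}))).

Lemma cyclic_par v x : par [set v]%SET x ->
  exists n, x = e v ^+ n \/ x = e v ^- n.
Proof.
move: x; apply: generated_ind => [|_ x [a + <-]|_ x [a + <-]].
- by exists 0; left.
- rewrite /= inE => /eqP -> [n [->|->]].
    by exists n.+1; left; rewrite expgS.
  case: n => [|n]; first by exists 1%N; left; rewrite invg1 mulg1.
  by exists n; right; rewrite expgSr invgM mulVKg.
- rewrite /= inE => /eqP -> [n [->|->]].
    case: n => [|n]; first by exists 1%N; right; rewrite mulg1.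
    by exists n; left; rewrite expgS mulKg.
  by exists n.+1; right; rewrite expgSr invgM.
Qed.

Lemma cyclic_par_expo0 v x : par [set v]%SET x -> expo v x = 0%R -> x = 1.
Proof.
case/cyclic_par => n [->|->]; rewrite ?expoV // expoX // expo_gen // eqxx;
  case: n => [|n]; rewrite ?expg0 ?invg1 //; lia.
Qed.

(** The dihedral Artin group on z and u, with c = zu and label 2k, is the amalgam
    of the free abelian group on u and the central element c^k with the infinite
    cyclic group of c, over the powers of c^k. *)
Variables z u : V.
Hypotheses (zu : edge Gamma z u) (label_gt2 : 2 < label Gamma z u).

Let k := (label Gamma z u)./2.
Let c : G := e z * e u.
Let Delta : G := c ^+ k.

Let k_gt1 : 1 < k.
Proof. by have := label_double Gamma_even zu; rewrite /k; lia. Qed.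

Let Gs (i : bool) : set G :=
  generated_subgroup (if i then [set x | x = e u \/ x = Delta]
                      else [set x | x = c]).

Let sGs i : subgroup (Gs i).
Proof. exact: subgroup_generated. Qed.

Let Gu : Gs true (e u).
Proof. by apply: mem_generated; left. Qed.

Let Gc : Gs false c.
Proof. exact: mem_generated. Qed.

Let commonDelta : common Gs Delta.
Proof.
split; first by apply: mem_generated; right.
rewrite /Delta; elim: (k) => [|n IH]; first exact: subgroup1.
by rewrite expgS; apply: (subgroupM (sGs _)).
Qed.

Let uDelta : commute (e u) Delta.
Proof.
have: Delta ^ (e u)^-1 = Delta.
  rewrite [RHS](artin_relation Gamma_even zu) conjXg; congr (_ ^+ _).
  by rewrite conjgE !gnorm.
by rewrite conjgE invgK mulgA => E; rewrite /commute -{2}E mulgVK.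
Qed.

(** The generator z acts as c * u^-1, a product of elements of the two factors. *)
Let f (a : V * bool) (w : nform G) : nform G :=
  if a.1 == u then act Gs true (letter R a) w
  else if a.1 == z then
    if a.2 then act Gs false c (act Gs true (e u)^-1 w)
    else act Gs true (e u) (act Gs false c^-1 w)
  else w.

Let Gs_letter b : Gs true (letter R (u, b)).
Proof. by case: b => //; exact: (subgroupV (sGs true)). Qed.

Let f_ok a w : normal Gs w -> normal Gs (f a w).
Proof.
have [GuV GcV] := (subgroupV (sGs true) Gu, subgroupV (sGs false) Gc).
case: a => v b nw; rewrite /f /=; case: eqP => [->|_].
  exact: act_normal.
by case: eqP => // _; case: b; do 2?apply: act_normal => //.
Qed.

Let f_cancel v b w : normal Gs w -> f (v, b) (f (v, ~~ b) w) = w.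
Proof.
have [GuV GcV] := (subgroupV (sGs true) Gu, subgroupV (sGs false) Gc).
move=> nw; rewrite /f /= letterN; case: eqP => [->|_]; first exact: act_inv.
case: eqP => // _; case: b => /=.
  by rewrite act_invV ?act_inv //; exact: act_normal.
by rewrite act_invV ?act_inv //; exact: act_normal.
Qed.

Let word_act_double (a b : V * bool) n w :
  word_act f (flatten (nseq n [:: a; b])) w = iter n (fun w => f a (f b w)) w.
Proof. by elim: n => //= n ->. Qed.

Let word_act_restrict x w :
  word_act f (restrict_word [set u; z]%SET x) w = word_act f x w.
Proof.
elim: x => //= a x IH; rewrite !inE.
case E: ((a.1 == u) || (a.1 == z)) => /=; rewrite IH // /f.
by case/norP: (negbT E) => /negPf -> /negPf ->.
Qed.

Let iter_c n w : normal Gs w ->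
  iter n (fun w => act Gs false c w) w = act Gs false (c ^+ n) w.
Proof.
have Gcn m : Gs false (c ^+ m).
  elim: m => [|m IH]; first exact: subgroup1.
  by rewrite expgS; exact: (subgroupM (sGs _)).
move=> nw; elim: n => [|n IH]; first by rewrite expg0 act1.
by rewrite iterS IH expgS [RHS]actM.
Qed.

Let f_rel l r w : R l r -> normal Gs w -> word_act f l w = word_act f r w.
Proof.
have [GuV GcV] := (subgroupV (sGs true) Gu, subgroupV (sGs false) Gc).
move=> lr nw; have [E|[ll rr]] := restrict_rel Gamma_even [set u; z]%SET lr.
  by rewrite -word_act_restrict E word_act_restrict.
have uz : u == z = false.
  by apply/eqP => E; have := zu; rewrite E edge_irr.
have zuk : word_act f (pos_word (prod_word z u k.*2)) w = act Gs true Delta w.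
  rewrite prod_word_double /pos_word map_flatten map_nseq /= word_act_double.
  transitivity (act Gs false Delta w); last exact: act_common.
  rewrite /Delta -iter_c //; elim: (k) => //= n ->.
  rewrite /f /= eqxx [z == u]eq_sym uz eqxx /letter /= act_invV //.
  elim: n => //= n IH; exact: act_normal.
have uzk : word_act f (pos_word (prod_word u z k.*2)) w = act Gs true Delta w.
  rewrite prod_word_double /pos_word map_flatten map_nseq /= word_act_double.
  transitivity (act Gs true (e u * Delta * (e u)^-1) w); last first.
    by rewrite uDelta mulgK.
  have GD : Gs true Delta by case: commonDelta.
  have nwu : normal Gs (act Gs true (e u)^-1 w) by exact: act_normal.
  rewrite [RHS]actM //; last exact: (subgroupM (sGs _)).
  rewrite [RHS]actM // (act_common sGs true false commonDelta nwu).
  rewrite -[act Gs false _ _]iter_c //.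
  have nit n : normal Gs (iter n (fun w => act Gs false c w)
      (act Gs true (e u)^-1 w)).
    by elim: n => //= n IH; exact: act_normal.
  elim: (k) => /= [|n ->]; first by rewrite act_inv.
  by rewrite /f /= eqxx [z == u]eq_sym uz eqxx /letter /= act_invV.
have uv : edge Gamma u z by rewrite edge_sym.
have luz : label Gamma u z = k.*2.
  by rewrite -(label_sym zu) [LHS](label_double Gamma_even).
have lzu : label Gamma z u = k.*2 by rewrite (label_sym zu).
case: lr ll rr => a b ab /all_filterP la _.
have [aS bS] : a \in [set u; z]%SET /\ b \in [set u; z]%SET.
  case: (label Gamma a b) (label_ge2 ab) la => [|[|n]] //= _.
  by case/and3P.
case/set2P: aS bS ab {la} => ->; case/set2P => ->; rewrite ?edge_irr // => _.
  by rewrite luz uzk zuk.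
by rewrite lzu uzk zuk.
Qed.

(** Both sides of the relation between z and u act as c^k: one of them directly,
    the other as its conjugate by u, and u commutes with c^k in the first
    factor. *)
Lemma dihedral_amalgam : free_amalgam Gs.
Proof.
apply: (ping_pong_generated sGs (alpha := group_act f)) => //.
- by move=> x w nw; exact: word_act_ok.
- by move=> w nw; rewrite (group_act_word (ok := normal Gs) _ _ _ [::]).
- by move=> x y w nw; exact: (group_actM f_ok f_cancel f_rel).
have [GuV GcV] := (subgroupV (sGs true) Gu, subgroupV (sGs false) Gc).
have alpha_c w : normal Gs w -> group_act f c w = act Gs false c w.
  move=> nw; rewrite (group_actM f_ok f_cancel f_rel) //.
  rewrite !(group_act_gen f_ok f_cancel f_rel) //; last exact: f_ok.
  have uz : z == u = false.
    by apply/eqP => E; have := zu; rewrite E edge_irr.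
  by rewrite /f /= !eqxx uz /letter /= act_invV.
move=> [] a w nw /=; last by move=> ->; exact: alpha_c.
case=> ->; first by rewrite (group_act_gen f_ok f_cancel f_rel) // /f /= eqxx.
rewrite (act_common sGs true false) // /Delta -iter_c //.
elim: (k) => [|n IH] /=.
  by rewrite (group_act_word f_ok f_cancel f_rel [::]).
rewrite expgS (group_actM f_ok f_cancel f_rel) // IH alpha_c //.
by elim: n {IH} => //= n IH; exact: act_normal.
Qed.

Let Gs_commute x y : par [set u]%SET x -> Gs true y -> commute x y.
Proof.
move=> ux Gy; have uy : commute y (e u).
  move: y Gy; apply: generated_sub; first exact: subgroup_commute.
  by move=> _ [->|->] //=; exact: commute_sym.
move: x ux; apply: generated_sub; first exact: subgroup_commute.
by move=> _ [v + <-] => /finset.set1P -> /=; exact: commute_sym.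
Qed.

Let u_neq_z : (u == z) = false.
Proof. by apply/eqP => E; have := zu; rewrite E edge_irr. Qed.

Let expo_c v : expo v c = ((z == v)%:Z + (u == v)%:Z)%R.
Proof. by rewrite expoM // !expo_gen. Qed.

Let expo_z x : Gs true x -> exists m : int, expo z x = (m * k%:Z)%R.
Proof.
move: x; apply: generated_sub => [|x [->|->]] /=.
- split=> [|x y [m mE] [n nE]|x [m mE]] /=.
  + by exists 0%R; rewrite expo1 //; lia.
  + by exists (m + n)%R; rewrite expoM // mE nE; lia.
  + by exists (- m)%R; rewrite expoV // mE; lia.
- by exists 0%R; rewrite expo_gen // u_neq_z; lia.
- by exists 1%R; rewrite expoX // expo_c eqxx u_neq_z; lia.
Qed.

Let expo_diag x : Gs false x -> expo z x = expo u x.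
Proof.
move: x; apply: generated_sub => [|x ->] /=; last first.
  by rewrite !expo_c !eqxx eq_sym; lia.
split=> [|x y|x] /=; first by rewrite !expo1.
  by rewrite !expoM // => -> ->.
by rewrite !expoV // => ->.
Qed.

Let c_not_common : ~ common Gs c.
Proof.
case=> /expo_z [m]; rewrite expo_c eqxx u_neq_z => /(congr1 absz).
by rewrite abszM /= => /esym/eqP; rewrite muln_eq1 => /andP[_ /eqP]; lia.
Qed.

Let cyclic_not_common x : par [set u]%SET x -> x <> 1 -> ~ common Gs x.
Proof.
move=> ux nx [_ /expo_diag E]; apply: nx; apply: (cyclic_par_expo0 ux).
have [n [xE|xE]] := cyclic_par ux; move: E; rewrite xE ?expoV // !expoX //;
  by rewrite !expo_gen // eqxx u_neq_z; lia.
Qed.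

(** A nontrivial power of u lies in the first factor, which is abelian, but not
    in the second: in the tree it fixes only one vertex. *)
Let amalgam_centralizer x g : par [set u]%SET x -> x <> 1 ->
  par [set z; u]%SET g -> commute x g -> Gs true g.
Proof.
move=> ux nx zug xg.
have Gx : Gs true x.
  move: x ux {nx xg}; apply: generated_sub => //.
  by move=> _ [v + <-] => /finset.set1P ->.
apply: (@centralizer_elliptic _ _ dihedral_amalgam Gs _ _ _ true x).
- exact: sGs.
- by move=> i y.
- by move=> i y Gy y0.
- exact: Gx.
- move=> h Gh; have -> : x ^ h = x.
    by rewrite conjgE (Gs_commute ux Gh) mulKg.
  exact: cyclic_not_common.
- move: g zug {xg}; apply: generated_sub; first exact: subgroup_generated.
  move=> _ [v + <-] => /finset.set2P [] ->; last first.
    by apply: mem_generated; left.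
  rewrite -[e z](mulgK (e u)); apply: (subgroupM (subgroup_generated _)).
    by apply: mem_generated; right.
  apply: (subgroupV (subgroup_generated _)).
  by apply: mem_generated; left.
- exact: commute_sym.
Qed.

Lemma dihedral_commute x g :
    par [set u]%SET x -> x <> 1 -> par [set z; u]%SET g -> commute x g ->
  commute (e u) g.
Proof.
move=> ux nx zug xg; apply: Gs_commute; first by apply: par_gen; rewrite inE.
exact: amalgam_centralizer xg.
Qed.

(** A nontrivial power of z = c * u^-1 is an alternating word and so is not in
    the first factor. *)
Lemma dihedral_commute_trivial x t :
    par [set u]%SET x -> par [set z]%SET t -> commute x t -> t <> 1 ->
  x = 1.
Proof.
move=> ux zt xt nt; apply: contrapT => nx.
have Gt : Gs true t.
  apply: (amalgam_centralizer ux nx _ xt).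
  by apply: parS zt => //; rewrite finset.sub1set !inE eqxx.
have Gut := subgroupV (sGs true) Gu.
have nu : ~ common Gs (e u)^-1.
  apply: cyclic_not_common; first by apply: (subgroupV (subgroup_par _ _));
    apply: par_gen; rewrite inE.
  by move/(congr1 (expo u)); rewrite expoV // expo_gen // expo1 // eqxx.
have red n : reduced Gs false (e z ^+ n.+1).
  have ez : e z = c * (e u)^-1 by rewrite mulgK.
  have red_cu y : common Gs y \/ reduced Gs false y ->
      reduced Gs false (c * ((e u)^-1 * y)).
    by move=> yP; apply: reduced_cons => //; apply: reduced_Ml.
  elim: n => [|n IH].
    rewrite expg1 ez -[(e u)^-1]mulg1; apply: red_cu; left.
    exact: subgroup1 (subgroup_common sGs).
  by rewrite expgS {1}ez -mulgA; apply: red_cu; right.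
have redN n : ~ Gs true (e z ^+ n.+1).
  exact: reduced_notin dihedral_amalgam _ _ (red n).
have [[|n] [tE|tE]] := cyclic_par zt.
- by apply: nt; rewrite tE.
- by apply: nt; rewrite tE invg1.
- by apply: (redN n); rewrite -tE.
- by apply: (redN n); rewrite -[_ ^+ _]invgK -tE; exact: (subgroupV (sGs true)).
Qed.

End Dihedral.

(** * The FC condition on triangles *)

(** Vertices 2i and 2i+1 of a half-line are exchanged by [pair_swap], and
    [link_swap col] exchanges 2i+1 and 2i+2 for those i that satisfy [col].  On a
    run of n consecutive pairs joined by links, which has 2n vertices, the
    composite of the two involutions is a 2n-cycle: together they
    generate a dihedral group of order 4n. *)
Section LineAction.
Local Open Scope nat_scope.

Definition pair_swap (p : nat) : nat := if odd p then p.-1 else p.+1.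

Definition link_swap (col : pred nat) (p : nat) : nat :=
  if odd p then (if col p./2 then p.+1 else p)
  else if p == 0 then 0 else if col p./2.-1 then p.-1 else p.

Lemma pair_swapK : involutive pair_swap.
Proof. by move=> p; rewrite /pair_swap; do 2?case: ifP; lia. Qed.

Lemma link_swapK col : involutive (link_swap col).
Proof.
move=> p; rewrite /link_swap; case p_odd: (odd p).
  case c: (col p./2); last by rewrite p_odd c.
  have -> : odd p.+1 = false by lia.
  have -> : p.+1./2.-1 = p./2 by lia.
  by rewrite c.
case: eqP => [->|p0] //=.
case c: (col p./2.-1); last first.
  by rewrite p_odd c; case: eqP.
have -> : odd p.-1 = true by lia.
have -> : p.-1./2 = p./2.-1 by lia.
  by rewrite c; lia.
Qed.

Lemma link_swapC col p :
  link_swap col (link_swap (predC col) p) =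
  link_swap (predC col) (link_swap col p).
Proof.
rewrite /link_swap /=; case p_odd: (odd p).
  have u1 : (uphalf p).-1 = p./2 by lia.
  by case c: (col p./2) => /=; rewrite ?p_odd ?c /= ?p_odd ?u1 ?c.
case: eqP => [_|p0] //=.
have o1 : odd p.-1 = true by lia.
have h1 : p.-1./2 = p./2.-1 by lia.
have p0' : (p == 0) = false by lia.
by case c: (col p./2.-1) => /=; rewrite ?p_odd ?p0' ?c ?o1 ?h1 ?c.
Qed.

Section Block.
Variables (col : pred nat) (s n : nat).
Hypotheses (n_gt0 : 0 < n) (linked : forall j, j < n.-1 -> col (s + j))
  (right_end : ~~ col (s + n.-1)) (left_end : 0 < s -> ~~ col s.-1).

(** The vertices of the run in the order of the cycle: first the left ends of the
    pairs from left to right, then the right ends from right to left. *)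
Definition block_point (t : nat) : nat :=
  if t < n then (s + t).*2 else (s + (n.*2.-1 - t)).*2.+1.

Lemma block_step t : t < n.*2 ->
  link_swap col (pair_swap (block_point t)) = block_point (t.+1 %% n.*2).
Proof.
move=> tn; rewrite /block_point; case: (ltnP t n) => tn'.
  rewrite /pair_swap odd_double /= /link_swap /= odd_double /= uphalf_double.
  have [t1|t1] := ltnP t n.-1.
    by rewrite linked // modn_small; [|lia]; case: ifP; lia.
  have -> : t = n.-1 by lia.
  by rewrite (negPf right_end) modn_small; [|lia]; case: ifP; lia.
rewrite /pair_swap /= odd_double /= /link_swap odd_double double_eq0 doubleK.
have [t1|t1] := ltnP t.+1 n.*2.
  have := linked (j := n.*2.-1 - t.+1).
  have -> : s + (n.*2.-1 - t.+1) = (s + (n.*2.-1 - t)).-1 by lia.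
  move=> -> //; last by lia.
  by rewrite modn_small //; case: ifP; case: ifP; lia.
have -> : t.+1 = n.*2 by lia.
rewrite modnn; have -> : n.*2.-1 - t = 0 by lia.
rewrite addn0 n_gt0; case: eqP => [-> //|s0].
by rewrite (negPf (left_end _)) //; lia.
Qed.

Lemma block_iter m t : t < n.*2 ->
  iter m (link_swap col \o pair_swap) (block_point t) =
    block_point ((t + m) %% n.*2).
Proof.
move=> tn; elim: m => [|m IH]; first by rewrite addn0 modn_small.
rewrite iterS IH /= block_step; last by rewrite ltn_mod; lia.
by rewrite -addn1 modnDml addn1 addnS.
Qed.

End Block.

Lemma line_order (col : pred nat) (n p : nat) :
    (forall i, exists s m, [/\ s <= i < s + m, m = 1%N \/ m = n,
      forall j, j < m.-1 -> col (s + j), ~~ col (s + m.-1)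
      & 0 < s -> ~~ col s.-1]) ->
  iter n.*2 (link_swap col \o pair_swap) p = p.
Proof.
move=> /(_ p./2) [s [m [/andP[si im] mn linked re le]]].
have m0 : 0 < m by lia.
have [t tm ->] : exists2 t, t < m.*2 & p = block_point s m t.
  rewrite /block_point; case p_odd: (odd p).
    by exists (m.*2.-1 - (p./2 - s)); [lia|case: ifP; lia].
  by exists (p./2 - s); [lia|case: ifP; lia].
rewrite block_iter //; congr block_point.
case: mn => mE; last by rewrite mE -[t + _]addnC modnDl modn_small // -mE.
move: tm; rewrite mE; case: t => [|[|]] // _; rewrite modn2 oddD odd_double //.
Qed.

Lemma iter_inverse (T : Type) (g h : T -> T) k p :
    (forall q, h (g q) = q) -> iter k.*2 g p = p ->
  iter k g p = iter k h p.
Proof.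
move=> gK E; have {}gK q : iter k h (iter k g q) = q.
  by elim: k {E} q => // k IH q; rewrite iterSr iterS gK IH.
by rewrite -[RHS]/(iter k h p) -{2}E -addnn iterD gK.
Qed.

End LineAction.

Section Triangles.
Local Open Scope nat_scope.
Variables (V : finType) (Gamma : artin_graph V).
Hypotheses (Gamma_even : even_graph Gamma) (Gamma_FC : FC_type Gamma).

(** Suppose that the labels 2a of xy and 2b of yw are both at least 4.  Let y act
    on the half-line by exchanging pairs, and let each link be moved by either x
    or w, in runs of a - 1 and b - 1 links.  Then the products of y with x and w
    have orders dividing 2a and 2b, while x and w commute.  As the runs are not
    empty, the action is transitive on an infinite set, so that the Coxeter
    group of the triangle is infinite. *)
Lemma FC_triangle x y w :
    edge Gamma x y -> edge Gamma y w -> edge Gamma x w ->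
  2 < label Gamma x y -> label Gamma y w = 2.
Proof.
move=> xy yw xw lxy; apply: contrapT => lyw.
pose S : {pred V} := [pred v | v \in [:: x; y; w]].
pose D := induced Gamma S.
have D_complete : complete_graph D.
  move=> [u uS] [v vS]; rewrite -val_eqE /= => uv; rewrite /D /=.
  have yx := xy; have wy := yw; have wx := xw.
  rewrite edge_sym in yx; rewrite edge_sym in wy; rewrite edge_sym in wx.
  move: uS vS uv; rewrite !inE.
  by case/or3P => /eqP ->; case/or3P => /eqP ->; rewrite ?eqxx.
have := Gamma_FC D_complete; rewrite /spherical -/D.
pose a := (label Gamma x y)./2; pose b := (label Gamma y w)./2.
have aE : label Gamma x y = a.*2 by exact: label_double.
have bE : label Gamma y w = b.*2 by exact: label_double.
have a_gt1 : 1 < a by lia.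
have b_gt1 : 1 < b by have := label_ge2 yw; lia.
pose N := (a + b).-2.
have N_gt0 : 0 < N by lia.
pose col : pred nat := fun i => i %% N < a.-1.
have xNy : (x == y) = false by apply/eqP => E; have := xy; rewrite E edge_irr.
have wNy : (w == y) = false by apply/eqP => E; have := yw; rewrite E edge_irr.
have wNx : (w == x) = false by apply/eqP => E; have := xw; rewrite E edge_irr.
pose g (v : V) := if v == y then pair_swap
  else if v == x then link_swap col else link_swap (predC col).
have gK v : involutive (g v).
  by rewrite /g; do 2?case: ifP => _; [exact: pair_swapK|exact: link_swapK..].
have modNP i : exists q r, i = q * N + r /\ r < N.
  by exists (i %/ N), (i %% N); rewrite -divn_eq ltn_mod.
have colE q r : r < N -> col (q * N + r) = (r < a.-1).
  by move=> rN; rewrite /col modnMDl modn_small.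
have colP q r : r < N -> 0 < q * N + r ->
    col (q * N + r).-1 = (0 < r < a).
  case: r => [|r] rN; last by rewrite addnS /= colE; lia.
  case: q => [|q] //; rewrite mulSn => _.
  have -> : (N + q * N + 0).-1 = q * N + N.-1 by lia.
  by rewrite colE; lia.
have order_x p : iter a.*2 (link_swap col \o pair_swap) p = p.
  apply: line_order => i; have [q [r [-> rN]]] := modNP i.
  have [ra|ra] := ltnP r a.
    exists (q * N), a; split; [lia|by right| | |].
    - by move=> j ja; rewrite colE; lia.
    - have [aN|aN] := ltnP a.-1 N; first by rewrite colE; lia.
      have -> : q * N + a.-1 = q.+1 * N + 0 by lia.
      by rewrite colE; lia.
    - by move=> q0; have := colP q 0; rewrite addn0 => ->.
  exists (q * N + r), 1%N; split; [lia|by left|by []| |].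
    by rewrite addn0 colE //; lia.
  by move=> i0; rewrite colP //; lia.
have order_w p : iter b.*2 (link_swap (predC col) \o pair_swap) p = p.
  have block q : exists s m, [/\ s = q * N + a.-1, m = b,
      forall j, j < m.-1 -> predC col (s + j), ~~ predC col (s + m.-1)
      & 0 < s -> ~~ predC col s.-1].
    exists (q * N + a.-1), b; split=> //= [j jb||_].
    - by rewrite -addnA colE; lia.
    - have -> : q * N + a.-1 + b.-1 = q.+1 * N + 0 by lia.
      by rewrite colE; lia.
    - by rewrite colP; lia.
  apply: line_order => i; have [q [r [-> rN]]] := modNP i.
  have [ra|ra] := ltnP r a.-1; last first.
    have [s [m [-> -> h1 h2 h3]]] := block q.
    by exists (q * N + a.-1), b; split=> //; [lia|right].
  have [i0|i0] := leqP (q * N + r) 0.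
    exists (q * N + r), 1%N; split; [lia|by left|by []| |lia].
    by rewrite addn0 /= colE // ra.
  have [r0|r0] := leqP r 0; last first.
    exists (q * N + r), 1%N; split; [lia|by left|by []| |].
      by rewrite addn0 /= colE // ra.
    by rewrite /= colP //; lia.
  case: q i0 => [|q] i0; first by lia.
  have [s [m [-> -> h1 h2 h3]]] := block q.
  by exists (q * N + a.-1), b; split=> //; [lia|right].
pose f (c : {v : V | v \in S} * bool) : nat -> nat := g (val c.1).
have f_cancel v c (p : nat) : True -> f (v, c) (f (v, ~~ c) p) = p.
  by move=> _; exact: gK.
have f_double u v k p : word_act f (pos_word (prod_word u v k.*2)) p =
    iter k (g (val u) \o g (val v)) p.
  by rewrite prod_word_double; elim: k => //= k <-.
have gy : g y = pair_swap by rewrite /g eqxx.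
have gx : g x = link_swap col by rewrite /g xNy eqxx.
have gw : g w = link_swap (predC col) by rewrite /g wNy wNx.
pose ok u v := forall k p, label Gamma u v = k.*2 -> edge Gamma u v ->
  iter k (g u \o g v) p = iter k (g v \o g u) p.
have okC u v : ok u v -> ok v u.
  move=> uv k p lk vu; rewrite -uv //; last by rewrite edge_sym.
  by rewrite -(label_sym vu).
have ok_order u v n : label Gamma u v = n.*2 ->
    (forall p, iter n.*2 (g u \o g v) p = p) -> ok u v.
  move=> ln E k p lk _; have -> : k = n by lia.
  by apply: iter_inverse => // q; rewrite /= !gK.
have okxy : ok x y by apply: ok_order aE _; rewrite gx gy.
have okwy : ok w y.
  by apply: (ok_order _ _ b); [rewrite -(label_sym yw)|rewrite gw gy].
have okxw : ok x w.
  by move=> k p _ _; apply: eq_iter => q; rewrite /= gx gw link_swapC.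
have okxx v : ok v v by move=> k p.
have f_rel l r p : artin_rel D l r -> word_act f l p = word_act f r p.
  case=> u v uv; have lE := label_double Gamma_even uv.
  rewrite -[label D u v]/(label Gamma (val u) (val v)) lE !f_double.
  suff okuv : ok (val u) (val v) by exact: okuv.
  have := valP u; have := valP v; rewrite /= !inE.
  by case/or3P => /eqP ->; case/or3P => /eqP -> //; exact: okC.
have cox_rel l r p : coxeter_rel D l r -> True ->
    word_act f l p = word_act f r p.
  by case=> [l' r' /f_rel -> //|v _]; rewrite /= /f gK.
have reach n : exists h : coxeter_group D, group_act f h 0 = n.
  elim: n => [|n [h hn]].
    by exists (of_word _ [::]); rewrite (group_act_word (ok := fun=> True)).
  suff [v vE] : exists v : {v : V | v \in S}, g (val v) n = n.+1.
    exists (pg_mul (gen _ v) h).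
    by rewrite (group_actM (ok := fun=> True)) // hn
      (group_act_gen (ok := fun=> True)).
  have [yS [xS wS]] : y \in S /\ x \in S /\ w \in S.
    by rewrite !inE !eqxx !orbT.
  case n_odd: (odd n); last first.
    by exists (Sub y yS); rewrite /= gy /pair_swap n_odd.
  case c: (col n./2).
    by exists (Sub x xS); rewrite /= gx /link_swap n_odd c.
  by exists (Sub w wS); rewrite /= gw /link_swap n_odd /= c.
move=> fin; apply: infinite_nat.
suff -> : [set: nat] = (fun h : coxeter_group D => group_act f h 0) @` setT.
  exact: finite_image.
by apply/seteqP; split=> // n _; have [h hn] := reach n; exists h.
Qed.

End Triangles.

(** * Parabolic subgroups *)

Section Parabolics.
Variables (V : finType) (Gamma : artin_graph V).
Hypothesis Gamma_even : even_graph Gamma.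

Local Notation G := (artin_group Gamma).
Local Notation e := (artin_gen Gamma).
Local Notation par S := (@standard_parabolic V Gamma (mem (S : {set V}))).
Implicit Types (A B C S : {set V}) (P Q : set G) (x y g h : G).

Lemma parabolicP P :
  parabolic P <-> exists g A, forall x, P x <-> par A (x ^ g).
Proof.
split=> [[g [S ->]]|[g [A PA]]].
  exists g, [set v in S]%SET => x; rewrite conj_setE.
  suff -> : standard_parabolic S = par [set v in S]%SET by [].
  congr generated_subgroup; apply/seteqP.
  by split=> _ [v vS <-]; exists v => //; move: vS; rewrite /= inE.
exists g, (fun v => v \in A); apply/seteqP; split=> x.
  by move/PA => Ax; apply/conj_setE.
by move/conj_setE => Ax; apply/PA.
Qed.

Lemma parabolic_par A : parabolic (par A).
Proof. by apply/parabolicP; exists 1, A => x; rewrite conjg1. Qed.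

Lemma parabolic_ext P Q : (forall x, P x <-> Q x) -> parabolic Q -> parabolic P.
Proof. by move=> PQ; suff -> : P = Q by []; apply/seteqP; split=> x /PQ. Qed.

Lemma parabolic_conj g P : parabolic P -> parabolic [set x | P (x ^ g)].
Proof.
move=> /parabolicP [h [A PA]]; apply/parabolicP; exists (g * h), A => x.
by rewrite conjgM; exact: PA.
Qed.

Lemma parJ A g x : par A g -> par A (x ^ g) <-> par A x.
Proof.
have sA := subgroup_par Gamma A; split=> Ax; last exact: (subgroupJ sA).
by rewrite -[x](conjgK g); apply: (subgroupJ sA) => //; exact: (subgroupV sA).
Qed.

(** Conjugating by [ret S g] instead of g does not change a parabolic subgroup
    that lies inside G_S. *)
Lemma parabolic_in S P : parabolic P -> P `<=` par S ->
  exists h B, [/\ par S h, B \subset S & forall x, P x <-> par B (x ^ h)].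
Proof.
move=> /parabolicP [g [A PA]] PS; exists (ret S g), (S :&: A)%SET.
split=> [||x]; [exact: ret_par|exact: finset.subsetIl|split=> [Px|]].
  rewrite -{1}(ret_id Gamma_even (PS _ Px)) -retJ //.
  by apply: ret_capl => //; exact/PA.
set y := x ^ _ => yD.
have Py : P (y ^ g^-1).
  by apply/PA; rewrite conjgKV; apply: parS yD => //; exact: finset.subsetIr.
suff -> : x = y ^ g^-1 by exact: Py.
rewrite -(ret_id Gamma_even (PS _ Py)) retJ // retV //.
rewrite (ret_id Gamma_even (parS Gamma_even (finset.subsetIl S A) yD)).
by rewrite /y conjgK.
Qed.

(** The set is the intersection of G_A with gG_Ag^-1. *)
Definition inter_conj_parabolic S A := forall g, par S g ->
  parabolic [set x | par A x /\ par A (x ^ g)].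

Definition inter_closed S := forall A, A \subset S -> inter_conj_parabolic S A.

(** For G_B and gG_Cg^-1, retracting to G_B and to G_C shows that a common element
    already lies in the conjugates of G_D, with D the intersection of B and C,
    by [ret B g] and by g * (ret C g)^-1. *)
Lemma inter_closed_setI S P Q : inter_closed S ->
    parabolic P -> parabolic Q -> P `<=` par S -> Q `<=` par S ->
  parabolic (P `&` Q).
Proof.
have sp := @subgroup_par V Gamma.
move=> IS pP pQ PS QS.
have [h [B [Sh BS PB]]] := parabolic_in pP PS.
have [k [C [Sk CS QC]]] := parabolic_in pQ QS.
pose g := h^-1 * k; pose p := ret B g; pose q := ret C g.
pose D := (B :&: C)%SET.
have Bp : par B p by exact: ret_par.
have Cq : par C q by exact: ret_par.
have DB : D \subset B by exact: finset.subsetIl.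
have DC : D \subset C by exact: finset.subsetIr.
have Sg : par S g by apply: (subgroupM (sp _)) => //; exact: (subgroupV (sp _)).
have Sg' : par S (p^-1 * g * q^-1).
  apply: (subgroupM (sp _)); first apply: (subgroupM (sp _)) => //.
    by apply: (subgroupV (sp _)); exact: parS Bp.
  by apply: (subgroupV (sp _)); exact: parS Cq.
have := IS D (fintype.subset_trans DB BS) _ Sg'.
move/(parabolic_conj (h * p)); apply: parabolic_ext => x /=.
have -> : x ^ (h * p) = (x ^ h) ^ p by rewrite conjgM.
set y := x ^ h.
have -> : (y ^ p) ^ (p^-1 * g * q^-1) = y ^ (g * q^-1).
  by rewrite -conjgM !mulgA mulgV mul1g.
apply: (@iff_trans _ (par B y /\ par C (y ^ g))).
  by rewrite -conjgM mulVKg; split=> [[/PB ? /QC ?]|[/PB ? /QC ?]].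
split=> [[By Cyg]|[Dy1 Dy2]]; split.
- rewrite -(ret_id Gamma_even By) -retJ //.
  exact: ret_capl.
- rewrite conjgM -(ret_id Gamma_even Cyg) retJ // -/q conjgK.
  by rewrite /D finset.setIC; exact: ret_capl.
- by apply/(parJ y Bp); exact: parS Dy1.
- apply/(parJ _ (subgroupV (sp _) Cq)); rewrite -conjgM.
  exact: parS Dy2.
Qed.

(** The intersection Q for the larger set A' is parabolic.  Both G_A and its
    conjugate meet Q in parabolic subgroups, since each of these intersections
    takes place inside a conjugate of G_A'. *)
Lemma inter_conj_mono S A A' : A \subset A' -> A' \subset S ->
    inter_conj_parabolic S A' -> inter_closed A' ->
  inter_conj_parabolic S A.
Proof.
move=> AA' A'S ISA' IA' g Sg; have Qpar := ISA' g Sg.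
set Q := [set x | _] in Qpar; have QA' : Q `<=` par A' by move=> x [].
have AA'p : par A `<=` par A' by exact: parS.
pose R1 := par A `&` Q.
have R1par : parabolic R1 by apply: (inter_closed_setI IA') => //;
  exact: parabolic_par.
pose R2' := par A `&` [set y | Q (y ^ g^-1)].
have R2'par : parabolic R2'.
  apply: (inter_closed_setI IA') => //; first exact: parabolic_par.
    exact: parabolic_conj.
  by move=> y [_]; rewrite conjgKV.
have R2par := parabolic_conj g R2'par.
have: parabolic (R1 `&` [set x | R2' (x ^ g)]).
  apply: (inter_closed_setI IA') => //; first by move=> x [_ /QA'].
  by move=> x [_]; rewrite /= conjgK => /QA'.
apply: parabolic_ext => x; split=> [[Ax Axg]|[[Ax _] [Axg _]]] //.
have Qx : Q x by split; exact: AA'p.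
by split; [|split=> //=; rewrite conjgK].
Qed.

(** Changing g by an element of G_A makes [ret A g] trivial; conjugation by such a
    g followed by the retraction is the identity on G_A, so elements of G_A that
    stay in G_A are fixed. *)
Lemma inter_conj_centralizer S A : A \subset S ->
    (forall g, par S g -> ret A g = 1 ->
      parabolic [set x | par A x /\ commute x g]) ->
  inter_conj_parabolic S A.
Proof.
have sp := @subgroup_par V Gamma.
move=> AS IA g Sg; pose r := ret A g; have Ar : par A r by exact: ret_par.
have ArV := subgroupV (sp _) Ar.
have Sg' : par S (g * r^-1).
  by apply: (subgroupM (sp _)) => //; exact: parS ArV.
have ret1g : ret A (g * r^-1) = 1 by rewrite retM // (ret_id _ ArV) // mulgV.
apply: parabolic_ext (IA _ Sg' ret1g) => x /=; split=> [[Ax Axg]|[Ax xg]].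
  have E : x ^ (g * r^-1) = x.
    have Axgr : par A (x ^ (g * r^-1)) by rewrite conjgM; exact/parJ.
    by rewrite -(ret_id Gamma_even Axgr) retJ // ret1g conjg1 ret_id.
  by split=> //; rewrite /commute conjgC E.
split=> //; have -> : x ^ g = x ^ r; last exact/parJ.
by rewrite -[in RHS](mulKg (g * r^-1) x) -xg -conjgE -conjgM mulgVK.
Qed.

(** If the centralizer of g lies in the subgroup lG_Bl^-1 of G_L, then it is the
    intersection of this subgroup with its conjugate by g. *)
Lemma centralizer_parabolic S (L : {set V}) B g l :
    L \subset S -> B \subset L ->
    inter_conj_parabolic S B -> par S g -> ret L g = 1 -> par L l ->
    (forall x, par L x -> commute x g -> par B (x ^ l)) ->
  parabolic [set x | par L x /\ commute x g].
Proof.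
have sp := @subgroup_par V Gamma.
move=> LS BL IB Sg g1 Ll cB.
have Sl : par S l by exact: parS Ll.
have := parabolic_conj l (IB (g ^ l) (subgroupJ (sp _) Sg Sl)).
apply: parabolic_ext => x /=; rewrite -conjJg; split=> [[Lx xg]|[Bx Bxg]].
  have -> : x ^ g = x by rewrite conjgE xg mulKg.
  by split; exact: cB.
have Lx : par L x by apply/(parJ x Ll); exact: parS Bx.
have Lxg : par L (x ^ g) by apply/(parJ _ Ll); exact: parS Bxg.
split=> //; rewrite /commute conjgC -(ret_id Gamma_even Lxg) retJ // g1 conjg1.
by rewrite ret_id.
Qed.

(** * Removing a generator by splitting along its star *)

Section Star.
Variables (S : {set V}) (z : V).

Let S1 := (S :\ z)%SET.
Let S2 := [set v in S | (v == z) || edge Gamma z v]%SET.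

Lemma star_cover : z \in S -> (S1 :|: S2)%SET = S.
Proof.
move=> zS; apply/setP => v; rewrite !inE.
by case: eqP => [->|]; rewrite ?zS //=; case: (v \in S).
Qed.

Lemma star_amalgam :
  free_amalgam (fun i => par (if i then S1 else S2)).
Proof.
apply: separation_amalgam => // a b; rewrite !inE => /andP[az aS].
move=> /andP[bS _] ab; have [bz|bz] := eqVneq b z; last by right.
by left; rewrite aS (negPf az) /= edge_sym -bz.
Qed.

Lemma star_proper (y : V) :
  y \in S -> z != y -> ~~ edge Gamma z y -> S2 \proper S.
Proof.
move=> yS zy zyN; apply/properP; split.
  by apply/fintype.subsetP => v; rewrite inE => /andP[].
by exists y; rewrite // inE yS eq_sym (negPf zy).
Qed.

(** By induction on a reduced word for g: peeling off a syllable s of the second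
    factor adds to the intersection already known the condition of fixing the
    two edges at s. *)
Lemma noncone_inter_conj : z \in S -> inter_closed S1 -> inter_closed S2 ->
  inter_conj_parabolic S S1.
Proof.
move=> zS I1 I2 g; rewrite -{1}(star_cover zS) -par_generatedU // => Sg.
have am := star_amalgam.
pose K g := parabolic [set x | par S1 x /\ par S1 (x ^ g)].
have sp := @subgroup_par V Gamma.
have K1 a : par S1 a -> K a.
  move=> Sa; apply: parabolic_ext (parabolic_par S1) => x.
  by split=> [[]//|Sx]; split=> //; exact/parJ.
have KM a h : par S1 a -> K h -> K (a * h).
  move=> Sa /(parabolic_conj a); apply: parabolic_ext => x /=.
  by rewrite conjgM; split=> -[Sx Sxh]; split=> //; apply/(parJ x Sa).
have commonE x : common (fun i => par (if i then S1 else S2)) x <->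
    par (S1 :&: S2) x.
  split=> [[x1 x2]|x12]; first exact: parI.
  by split; apply: parS x12 => //; [exact: finset.subsetIl|
    exact: finset.subsetIr].
have K2 s : par S2 s -> parabolic [set x | par (S1 :&: S2) x /\
    par (S1 :&: S2) (x ^ s)].
  by apply: I2; exact: finset.subsetIr.
pose Gs i := par (if i then S1 else S2).
suff Kred i h : reduced Gs i h -> K h.
  have [[g1 _]|[i rg]] := reduced_cover (amalgam_subgroup am) Sg.
    exact: K1.
  exact: Kred rg.
elim=> {i h} [[] s Gi ns|[] s h Gi ns rh IH]; [exact: K1| |exact: KM|].
  apply: parabolic_ext (K2 s Gi) => x /=.
  split=> [[x1 xs1]|[/commonE[x1 _] /commonE[xs1 _]]] //.
  have [x0 xs0] : common Gs x /\ common Gs (x ^ s).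
    apply: (conj_syllable_common am (i := true) (g := 1)) => //.
      by left; exact: subgroup1 (subgroup_common (amalgam_subgroup am)).
    by rewrite mulg1.
  by split; exact/commonE.
have K2' := K2 _ (subgroupV (sp _) Gi).
have: parabolic ([set x | par (S1 :&: S2) x /\ par (S1 :&: S2) (x ^ s^-1)]
    `&` [set x | par S1 x /\ par S1 (x ^ h)]).
  apply: (inter_closed_setI I1) => // x []; last by [].
  by move=> /commonE[].
move/(parabolic_conj s); apply: parabolic_ext => x /=; rewrite conjgK.
split=> [[x1 xsh]|[[_ /commonE[x1 _]] [_ xsh]]]; last first.
  by split=> //; rewrite conjgM.
have [x0 xs0] : common Gs x /\ common Gs (x ^ s).
  by apply: (conj_syllable_common am (i := true) (g := h)) => //; right.
split; first by split; exact/commonE.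
by split; [case: xs0|rewrite -conjgM].
Qed.

End Star.

End Parabolics.

(** * Removing a generator joined to all others *)

Section Cones.
Variables (V : finType) (Gamma : artin_graph V).
Hypotheses (Gamma_even : even_graph Gamma) (Gamma_FC : FC_type Gamma).

Local Notation G := (artin_group Gamma).
Local Notation e := (artin_gen Gamma).
Local Notation par S := (@standard_parabolic V Gamma (mem (S : {set V}))).
Implicit Types (A B C S : {set V}) (P Q : set G) (x y g h : G).

Let sp := @subgroup_par V Gamma.

Lemma label_eq2 (u v : V) :
  edge Gamma u v -> ~~ (2 < label Gamma u v) -> label Gamma u v = 2.
Proof. by move=> /label_ge2; lia. Qed.

Section Cone.
Variables (S : {set V}) (z : V).
Hypothesis zS : z \in S.
Hypothesis cone : forall v, v \in S -> v != z -> edge Gamma z v.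

Let L := (S :\ z)%SET.

Let LS : L \subset S.
Proof. exact: subD1set. Qed.

Lemma central_inter_conj :
  (forall v, v \in L -> label Gamma z v = 2) -> inter_conj_parabolic Gamma S L.
Proof.
move=> l2; have comm a b : a \in L -> b \in [set z]%SET ->
    commute (e a) (e b).
  move=> aL /finset.set1P ->; apply: commute_sym; apply: commute_label2 => //.
    by apply: cone; move: aL; rewrite !inE => /andP[].
  exact: l2.
have Lz : (L :&: [set z])%SET = finset.set0.
  by apply/setP => v; rewrite !inE; case: eqP; rewrite ?andbF.
apply: inter_conj_centralizer => // g Sg g1.
apply: parabolic_ext (parabolic_par Gamma L) => x; split=> [[]//|Lx].
split=> //; have Sg' : par (L :|: [set z]) g.
  by rewrite finset.setUC finset.setD1K.
rewrite (par_prod Gamma_even Lz comm Sg') g1 mul1g.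
by apply: (commute_par comm Lx); exact: ret_par.
Qed.

Section LargeLabel.
Variable u : V.
Hypotheses (uL : u \in L) (zu_gt2 : 2 < label Gamma z u).

Let uz : u != z.
Proof. by move: uL; rewrite !inE => /andP[]. Qed.

Let uS : u \in S.
Proof. by move: uL; rewrite !inE => /andP[]. Qed.

Let zu : edge Gamma z u.
Proof. exact: cone. Qed.

(** The triangle on u, z and v already has the label of uz greater than 2. *)
Lemma commute_link v : v \in L -> edge Gamma u v ->
  commute (e z) (e v) /\ commute (e u) (e v).
Proof.
rewrite !inE => /andP[vz vS] uv; have zv := cone vS vz.
have uz' : edge Gamma u z by rewrite edge_sym.
have luz : 2 < label Gamma u z by rewrite -(label_sym zu).
split; apply: (commute_label2 Gamma_even) => //.
  exact: (FC_triangle Gamma_even Gamma_FC uz' zv uv luz).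
exact: (FC_triangle Gamma_even Gamma_FC zu uv zv zu_gt2).
Qed.

(** The kernel of [ret L] lies in the dihedral factor, so the other factor
    centralizes g; by [dihedral_commute], either no nontrivial power of u
    commutes with g, or u itself does. *)
Lemma dihedral_inter_conj :
    (forall v, v \in S -> v != u -> edge Gamma u v) ->
  inter_conj_parabolic Gamma S L.
Proof.
move=> ucone; pose L2 := (L :\ u)%SET.
have comm v : v \in L2 -> commute (e z) (e v) /\ commute (e u) (e v).
  rewrite inE => /andP[vu vL]; apply: commute_link => //.
  by apply: ucone; move: vL vu; rewrite !inE => // /andP[].
have commA a b : a \in [set z; u]%SET -> b \in L2 -> commute (e a) (e b).
  by move=> /finset.set2P[] -> /comm [].
have commU a b : a \in [set u]%SET -> b \in L2 -> commute (e a) (e b).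
  by move=> /finset.set1P -> /comm [].
have dA : ([set z; u] :&: L2)%SET = finset.set0.
  apply/setP => v; rewrite !inE.
  by case: (v == z) => //=; [rewrite andbF|case: (v == u)].
have dU : ([set u] :&: L2)%SET = finset.set0.
  by apply/setP => v; rewrite !inE; case: (v == u).
have SE : S = ([set z; u] :|: L2)%SET.
  apply/setP => v; rewrite !inE.
  by case: eqP => [->|] //=; case: eqP => [->|].
have LE : L = ([set u] :|: L2)%SET.
  apply/setP => v; rewrite !inE.
  by case: (eqVneq v u) => [->|] //=; rewrite uz uS.
apply: inter_conj_centralizer => // g Sg g1.
have gE : g = ret [set z; u] g.
  rewrite SE in Sg; rewrite {1}(par_prod Gamma_even dA commA Sg).
  suff -> : ret L2 g = 1 by rewrite mulg1.
  by rewrite -(ret_mono Gamma_even (B := L)) ?g1 ?ret1 // subD1set.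
have Ag : par [set z; u]%SET g by rewrite gE; exact: ret_par.
have L2g x : par L2 x -> commute x g.
  by move=> L2x; apply: commute_sym; exact: commute_par commA Ag L2x.
have LxE x : par L x -> x = ret [set u] x * ret L2 x.
  by rewrite {1}LE; exact: par_prod.
have [[x [Lx xg nx]]|no] := EM (exists x, [/\ par L x, commute x g
    & ret [set u] x <> 1]).
  have ug : commute (e u) g.
    apply: (dihedral_commute Gamma_even zu zu_gt2 (x := ret [set u] x)) => //.
      exact: ret_par.
    have -> : ret [set u] x = x * (ret L2 x)^-1.
      by rewrite {2}(LxE _ Lx) mulgK.
    apply: commute_sym; apply: commuteM; first exact: commute_sym.
    by apply: commuteV; apply: commute_sym; apply: L2g; exact: ret_par.
  apply: parabolic_ext (parabolic_par Gamma L) => y; split=> [[]//|Ly].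
  split=> //; move: y Ly; apply: generated_sub; first exact: subgroup_commute.
  move=> _ [v + <-]; rewrite /= LE => /finset.setU1P[->//|vL2].
  by apply: L2g; exact: par_gen.
apply: parabolic_ext (parabolic_par Gamma L2) => x; split=> [[Lx xg]|L2x].
  rewrite (LxE _ Lx); have -> : ret [set u] x = 1.
    by apply: contrapT => nx; apply: no; exists x.
  by rewrite mul1g; exact: ret_par.
by split; [apply: parS L2x => //; exact: subD1set|exact: L2g].
Qed.

(** The splitting of G_S along the star of u, together with the subgroup G_L
    generated by its intersections with the two factors. *)
Section FixedTree.

Let S1 := (S :\ u)%SET.
Let S2 := [set v in S | (v == u) || edge Gamma u v]%SET.
Let Gs i : set G := par (if i then S1 else S2).
Let Hs i : set G := par ((if i then S1 else S2) :\ z).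
Let W := ((S1 :&: S2) :\ z)%SET.

Let am : free_amalgam Gs.
Proof. exact: star_amalgam. Qed.

Let commW a b : a \in [set z; u]%SET -> b \in W -> commute (e a) (e b).
Proof.
move=> azu bW; have [] : commute (e z) (e b) /\ commute (e u) (e b).
  move: bW; rewrite !inE => /andP[bz /andP[/andP[/negPf bu bS] /andP[_]]].
  by rewrite bu; apply: commute_link; rewrite !inE bz.
by case/finset.set2P: azu => ->.
Qed.

(** So an element of the kernel that fixes an edge of the subtree is conjugate to
    a power of z. *)
Let common_kernel x : common Gs x -> ret L x = 1 -> par [set z]%SET x.
Proof.
move=> [x1 x2] xL; have cE : (S1 :&: S2)%SET = ([set z] :|: W)%SET.
  by rewrite finset.setD1K // !inE eq_sym uz zS (edge_sym Gamma u z) zu orbT.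
have := parI Gamma_even x1 x2; rewrite cE => x12.
have comm a b : a \in [set z]%SET -> b \in W -> commute (e a) (e b).
  by move=> /finset.set1P -> ; apply: commW; rewrite !inE eqxx.
rewrite (par_prod Gamma_even _ comm x12); last first.
  by apply/setP => v; rewrite !inE; case: eqP.
have -> : ret W x = 1; last by rewrite mulg1; exact: ret_par.
rewrite -(ret_mono Gamma_even (B := L)) ?xL ?ret1 //.
by apply/fintype.subsetP => v; rewrite !inE => /andP[-> /andP[/andP[_ ->]]].
Qed.

Let sGs i : subgroup (Gs i).
Proof. exact: sp. Qed.

Let sHs i : subgroup (Hs i).
Proof. exact: sp. Qed.

Let HsG i : Hs i `<=` Gs i.
Proof. by apply: parS => //; exact: subD1set. Qed.

Let Hs_common i x : Hs i x -> common Gs x -> common Hs x.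
Proof.
move=> Hx [x1 x2]; have H1 := parI Gamma_even Hx x1.
have H2 := parI Gamma_even Hx x2.
have sub A B c : (A :\ c) :&: B \subset B :\ c.
  by apply/fintype.subsetP => v; rewrite !inE => /andP[/andP[-> _]].
by split; [apply: parS H1|apply: parS H2] => //; exact: sub.
Qed.

Let HsL i : (if i then S1 else S2) :\ z \subset L.
Proof.
apply: finset.setSD; case: i; first exact: subD1set.
by apply/fintype.subsetP => v; rewrite inE => /andP[].
Qed.

Let HE : subamalgam Hs = par L.
Proof.
rewrite /subamalgam par_generatedU //; congr (par _); rewrite -finset.setDUl.
by rewrite star_cover.
Qed.

(** The hypothesis of [centralizer_common] for a power of z: on the generators
    joined to u and z conjugation is trivial, and a power of u does not commute
    with a power of z. *)
Let conj_common_eq l h t : par L l -> par L h -> common Gs (t ^ l) ->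
  common Gs (t ^ (l * h)) -> ret L t = 1 -> Hs false h -> t <> 1 ->
  common Hs h.
Proof.
move=> Ll Lh cl clh t1 Hh nt; set b := t ^ l in cl.
have bL : ret L b = 1 by rewrite retJ // t1 conj1g.
have bz := common_kernel cl bL.
rewrite conjgM -/b in clh.
have cz : par [set z]%SET (b ^ h).
  by apply: common_kernel clh _; rewrite retJ // bL conj1g.
have comm a c : a \in [set u]%SET -> c \in W -> commute (e a) (e c).
  by move=> /finset.set1P ->; apply: commW; rewrite !inE eqxx orbT.
have commz a c : a \in [set z]%SET -> c \in W -> commute (e a) (e c).
  by move=> /finset.set1P ->; apply: commW; rewrite !inE eqxx.
have SE : (S2 :\ z)%SET = ([set u] :|: W)%SET.
  apply/setP => v; rewrite !inE; have [->|] := eqVneq v u.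
    by rewrite uz uS.
  by rewrite /= ; case: (v == z); case: (v \in S).
have hE : h = ret [set u] h * ret W h.
  apply: (par_prod Gamma_even _ comm); last by rewrite -SE.
  by apply/setP => v; rewrite !inE; case: eqP; rewrite ?andbF.
have uh : par [set u]%SET (ret [set u] h) by exact: ret_par.
have Wh : par W (ret W h) by exact: ret_par.
have bh : b ^ h = b ^ ret [set u] h.
  rewrite {1}hE (commute_par comm uh Wh) conjgM; congr (_ ^ _).
  by rewrite conjgE (commute_par commz bz Wh) mulKg.
have bu : b ^ ret [set u] h = b.
  rewrite -bh -(ret_id Gamma_even cz) bh retJ // (ret_id Gamma_even bz).
  rewrite (ret_disjoint Gamma_even _ uh) ?conjg1 //.
  by apply/setP => v; rewrite !inE; case: eqP => // ->; rewrite (negPf uz).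
have u1 : ret [set u] h = 1.
  apply: (dihedral_commute_trivial Gamma_even zu zu_gt2 uh bz).
    by apply: commute_sym; rewrite /commute conjgC bu.
  by move=> b1; apply: nt; rewrite -[t](conjgK l) -/b b1 conj1g.
rewrite hE u1 mul1g; split; apply: parS Wh => //; apply: finset.setSD.
  exact: finset.subsetIl.
exact: finset.subsetIr.
Qed.

Lemma fixed_tree_inter_conj :
    inter_conj_parabolic Gamma S (S1 :\ z) ->
    inter_conj_parabolic Gamma S (S2 :\ z) ->
  inter_conj_parabolic Gamma S L.
Proof.
move=> I1 I2; have IB i : inter_conj_parabolic Gamma S
    ((if i then S1 else S2) :\ z) by case: i.
apply: inter_conj_centralizer => // g Sg g1.
have finish l i : par L l ->
    (forall x, par L x -> commute x g -> Hs i (x ^ l)) ->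
    parabolic [set x | par L x /\ commute x g].
  exact: (centralizer_parabolic Gamma_even LS (HsL i) (IB i) Sg g1).
have Sg' : generated_subgroup (Gs true `|` Gs false) g.
  by rewrite par_generatedU // star_cover.
have := double_coset_or_away am sHs HsG Hs_common Sg'; rewrite HE.
case=> [[i [l [a [l' [Ll Ll' Ga gE]]]]]|[l [i [Ll]]]]; last exact: finish.
pose r := ret L a; pose b := a * r^-1.
have Gr : Gs i r.
  apply: (parS Gamma_even (finset.subsetIr L _)).
  by rewrite /r; apply: ret_capl Ga.
have Gb : Gs i b.
  by apply: (subgroupM (sGs i)) => //; exact: (subgroupV (sGs i)).
have Lr : par L r by exact: ret_par.
have rE : ret L b = 1.
  by rewrite retM // retV // (ret_id Gamma_even Lr) mulgV.
have gb : g ^ l = b.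
  have : l * r * l' = 1.
    by rewrite -g1 gE !retM // (ret_id Gamma_even Ll) (ret_id Gamma_even Ll').
  move=> E; have -> : b = a * (l' * l); last first.
    by rewrite gE conjgE !mulgA mulVg mul1g.
  by congr (a * _); apply: mulg1_eq; apply: (mulgI l); rewrite !mulgA E !gnorm.
have comm_b x : commute x g -> commute (x ^ l) b.
  by move=> xg; rewrite -gb /commute -!conjMg xg.
(* Now b is in the kernel and fixes the base vertex of [Gs i]; either it fixes no
   edge of the subtree there, or it is conjugate to a power of z. *)
have [[h [Hh ch]]|no] := EM (exists h, Hs i h /\ common Gs (b ^ h)); last first.
  apply: (finish l i) => // x Lx xg.
  apply: (centralizer_elliptic am sHs HsG Hs_common (a := b)) => //.
  - by move=> h Hh ch; apply: no; exists h.
  - by rewrite HE; apply: (subgroupJ (sp L)).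
  - exact: comm_b.
have Lh : par L h by apply: parS Hh => //; exact: HsL.
have [t1|nt] := EM (b ^ h = 1).
  have b1 : b = 1 by rewrite -[b](conjgK h) t1 conj1g.
  have {}g1 : g = 1 by rewrite -[g](conjgK l) gb b1 conj1g.
  apply: parabolic_ext (parabolic_par Gamma L) => x; split=> [[]//|Lx].
  by split=> //; rewrite g1; exact: commute1.
apply: (finish (l * h) true); first exact: (subgroupM (sp L)).
move=> x Lx xg; rewrite conjgM.
apply: (centralizer_common am sHs HsG Hs_common (t := b ^ h)) => //.
- move=> k j Hk Hj ck ckj; apply: (conj_common_eq _ _ ck ckj) => //.
  + by apply: parS Hk => //; exact: (HsL true).
  + by apply: parS Hj => //; exact: (HsL false).
  + by rewrite retJ // rE conj1g.
- by rewrite HE; do 2?apply: (subgroupJ (sp L)).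
- by rewrite /commute -!conjMg comm_b.
Qed.

End FixedTree.
End LargeLabel.
End Cone.
End Cones.

(** * Intersections of parabolic subgroups *)

Section Main.
Variables (V : finType) (Gamma : artin_graph V).
Hypotheses (Gamma_even : even_graph Gamma) (Gamma_FC : FC_type Gamma).

Local Notation G := (artin_group Gamma).
Local Notation par S := (@standard_parabolic V Gamma (mem (S : {set V}))).

Theorem inter_closed_even_FC (S : {set V}) : inter_closed Gamma S.
Proof.
have [n] := ubnP #|S|; elim: n S => // n IH S cardS.
have IHS (T : {set V}) : T \proper S -> inter_closed Gamma T.
  by move=> /proper_card TS; apply: IH; lia.
have D1_proper v : v \in S -> (S :\ v)%SET \proper S by exact: properD1.
have noncone v y : v \in S -> y \in S -> v != y -> ~~ edge Gamma v y ->
    inter_conj_parabolic Gamma S (S :\ v).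
  move=> vS yS vy vyN; apply: noncone_inter_conj => //; apply: IHS.
    exact: D1_proper.
  exact: (star_proper yS vy vyN).
have mono (A : {set V}) v : v \in S -> v \notin A -> A \subset S ->
    inter_conj_parabolic Gamma S (S :\ v) -> inter_conj_parabolic Gamma S A.
  move=> vS vA AS; move/inter_conj_mono; apply => //.
  - by rewrite finset.subsetD1 AS.
  - exact: subD1set.
  - exact/IHS/D1_proper.
move=> A AS; have [->|] := eqVneq A S.
  move=> g Sg; apply: parabolic_ext (parabolic_par Gamma S) => x.
  by split=> [[]//|Sx]; split=> //; exact/parJ.
rewrite finset.eqEsubset AS /= => /fintype.subsetPn [z zS zA].
apply: (mono A z) => //.
have [[y [yS zy zyN]]|zcone] :=
    EM (exists y, [/\ y \in S, z != y & ~~ edge Gamma z y]).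
  exact: (noncone z y).
have {}zcone v : v \in S -> v != z -> edge Gamma z v.
  move=> vS vz; apply: contrapT => /negP zv; apply: zcone.
  by exists v; rewrite eq_sym.
have [[u [uL zu]]|small] :=
    EM (exists u, u \in (S :\ z)%SET /\ 2 < label Gamma z u); last first.
  apply: central_inter_conj => // v vL; apply: label_eq2.
    by apply: zcone; move: vL; rewrite !inE => /andP[].
  by apply/negP => zv; apply: small; exists v.
have uS : u \in S by move: uL; rewrite !inE => /andP[].
have [[y [yS uy uyN]]|ucone] :=
    EM (exists y, [/\ y \in S, u != y & ~~ edge Gamma u y]); last first.
  apply: (dihedral_inter_conj Gamma_even Gamma_FC zS zcone uL zu) => v vS vu.
  by apply: contrapT => /negP uv; apply: ucone; exists v; rewrite eq_sym.
apply: (fixed_tree_inter_conj Gamma_even Gamma_FC zS zcone uL zu).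
  apply: (mono _ u) => //; last exact: (noncone u y).
    by rewrite !inE eqxx andbF.
  by apply: (fintype.subset_trans (subD1set _ _)); exact: subD1set.
apply: (mono _ y) => //.
- have yu : (y == u) = false by rewrite eq_sym (negPf uy).
  by rewrite !inE yu (negPf uyN) !andbF.
- apply/fintype.subsetP => v; rewrite !inE; by case/and3P.
- by apply: (noncone y u) => //; rewrite ?(edge_sym Gamma y) // eq_sym.
Qed.

Theorem parabolic_setI (P Q : set G) :
  parabolic P -> parabolic Q -> parabolic (P `&` Q).
Proof.
move=> pP pQ; apply: (inter_closed_setI Gamma_even (S := [set: V]%SET)) => //.
- exact: inter_closed_even_FC.
- by move=> x _; exact: parT.
- by move=> x _; exact: parT.
Qed.

(** Take a parabolic subgroup that contains the intersection and whose type B has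
    minimal size.  What it has in common with P i is another such subgroup, and
    its type can be taken inside B, so it is B and nothing has been lost. *)
Theorem parabolic_bigcap (I : Type) (P : I -> set G) :
  (forall i, parabolic (P i)) -> parabolic (\bigcap_(i in [set: I]) P i).
Proof.
move=> Ppar; pose above Q := \bigcap_(i in [set: I]) P i `<=` Q.
pose rank_le n := exists h (B : {set V}),
  #|B| <= n /\ above [set x | par B (x ^ h)].
have [n [[h [B [cardB aB]]] minn]] : exists n, rank_le n /\
    forall m, rank_le m -> n <= m.
  have ex : exists n, `[< rank_le n >].
    exists #|[set: V]%SET|; apply/asboolP; exists 1, [set: V]%SET; split=> //.
    by move=> x _; exact: parT.
  have [m /asboolP rm mm] := ex_minnP ex.
  by exists m; split=> // k rk; apply: mm; apply/asboolP.
pose Q := [set x | par B (x ^ h)].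
have Qpar : parabolic Q by apply/parabolicP; exists h, B.
suff QP i : Q `<=` P i.
  apply: parabolic_ext Qpar => x; split=> [/aB //|Qx i _]; exact: QP.
have := parabolic_conj h^-1 (parabolic_setI Qpar (Ppar i)).
have sub : [set x | (Q `&` P i) (x ^ h^-1)] `<=` par B.
  by move=> x [Qx _]; move: Qx; rewrite /Q /= conjgKV.
move=> /parabolic_in - /(_ Gamma_even _ sub) [l [C [Bl CB RC]]].
have eCB : C = B.
  apply/eqP; rewrite eqEcard CB /=; apply: (leq_trans cardB); apply: minn.
  exists (h * l), C; split=> // x Px; rewrite /= conjgM; apply/RC => /=.
  by rewrite conjgK; split; [exact: aB|exact: Px].
move=> x Qx; suff [] : (Q `&` P i) x by [].
rewrite -[x](conjgK h); apply/RC; rewrite eCB; exact/parJ.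
Qed.

End Main.

Theorem corollary5p3 (V : finType) (Gamma : artin_graph V)
    (Gamma_even : even_graph Gamma) (Gamma_FC : FC_type Gamma)
    (I : Type) (P : I -> set (artin_group Gamma))
    (P_parabolic : forall i : I, parabolic (P i)) :
  parabolic (\bigcap_(i in [set: I]) P i).
Proof. exact: parabolic_bigcap. Qed.
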